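(* The Offensive Alliance problem is NP-complete, even when restricted to split graphs or to chordal graphs.
   Context: All graphs are finite, simple and undirected. For $S\subseteq V(G)$, $N(S)$ is the open neighbourhood of $S$, $S^c=V(G)\setminus S$, and $d_S(v)$ is the number of neighbours of $v$ in $S$. A non-empty set $S\subseteq V(G)$ is an offensive alliance if $d_S(v)\ge d_{S^c}(v)+1$ for every $v\in N(S)$. Offensive Alliance: given a graph $G$ and integer $r\ge 1$, is there an offensive alliance $S$ with $1\le |S|\le r$? A graph is chordal if it has no chordless cycle of length at least four; it is split if its vertex set can be partitioned into an independent set and a clique. *)

(* Defs.v *)
From mathcomp Require Import all_boot.

Set Implicit Arguments.
Unset Strict Implicit.
Unset Printing Implicit Defensive.

(** * Deterministic multi-tape Turing machines *)

Definition word := seq bool.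

Inductive direction := GoLeft | Stay | GoRight.

(* [None] is the blank; [Some (inl b)] is an input/output bit; [Some (inr a)]
   is an additional symbol of the machine's work alphabet. *)
Definition symbol (A : finType) : finType := option (bool + A).

(* The machine has [last_tape.+1] tapes, so that there always is a tape 0. *)
Record machine := Machine {
  last_tape : nat;
  work_symbol : finType;
  state : finType;
  start : state;
  halting : pred state;
  delta : state -> {ffun 'I_last_tape.+1 -> symbol work_symbol} ->
    state * ('I_last_tape.+1 -> symbol work_symbol * direction)
}.

(* A two-way infinite tape.  [rside] starts with the scanned cell, [lside] lists
   the cells to its left, nearest first; all cells beyond the lists are blank. *)
Record tape (A : finType) := Tape {
  lside : seq (symbol A);
  rside : seq (symbol A)
}.

Definition scanned A (t : tape A) : symbol A := head None (rside t).

Definition write_move A (t : tape A) (sd : symbol A * direction) : tape A :=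
  let: (s, d) := sd in
  let l := lside t in
  let r := behead (rside t) in
  match d with
  | GoLeft => Tape (behead l) (head None l :: s :: r)
  | Stay => Tape l (s :: r)
  | GoRight => Tape (s :: l) r
  end.

Fixpoint read_bits A (s : seq (symbol A)) : word :=
  if s is Some (inl b) :: s' then b :: read_bits s' else [::].

Section Runs.

Variable M : machine.

Definition config : Type :=
  state M * {ffun 'I_(last_tape M).+1 -> tape (work_symbol M)}.

Definition halted (c : config) : bool := halting c.1.

Definition step (c : config) : config :=
  if halted c then c else
  let: (q, act) := delta c.1 [ffun i => scanned (c.2 i)] in
  (q, [ffun i => write_move (c.2 i) (act i)]).

(* The i-th input word is on tape i, with the head on its first letter; the
   remaining tapes are blank. *)
Definition initial (ws : seq word) : config :=
  (start M, [ffun i : 'I__ =>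
    Tape [::] [seq Some (inl b) | b <- nth [::] ws i]]).

(* The output is read on tape 0 from the head rightwards, up to the first
   symbol which is not a bit. *)
Definition output (c : config) : word := read_bits (rside (c.2 ord0)).

(* A halted configuration is a fixed point of [step], so that this says that
   [M] halts after at most [t] steps. *)
Definition outputs_within (ws : seq word) (t : nat) (out : word) : Prop :=
  let c := iter t step (initial ws) in halted c /\ output c = out.

End Runs.

(** * NP-completeness *)

Definition language := word -> Prop.

Definition polytime_function (f : word -> word) : Prop :=
  exists (M : machine) (c k : nat), forall x : word,
    outputs_within M [:: x] (c * size x ^ k + c) (f x).

Definition polytime_relation (V : word -> word -> bool) : Prop :=
  exists (M : machine) (c k : nat), forall x y : word,
    outputs_within M [:: x; y] (c * (size x + size y) ^ k + c) [:: V x y].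

Definition in_NP (L : language) : Prop :=
  exists (V : word -> word -> bool) (c k : nat),
    polytime_relation V /\
    forall x : word,
      L x <-> exists y : word, size y <= c * size x ^ k + c /\ V x y.

(* A decision problem, through the words that encode its instances and those
   that encode its yes-instances. *)
Record problem := Problem {
  instance : language;
  yes : language;
  yes_instance : forall w, yes w -> instance w
}.

(* Reductions produce instances of the problem, so that hardness of a problem
   restricted to a class is not obtained from words outside of the class. *)
Definition NP_hard (P : problem) : Prop :=
  forall L : language, in_NP L ->
    exists f : word -> word, polytime_function f /\
      forall x : word, instance P (f x) /\ (L x <-> yes P (f x)).

Definition NP_complete (P : problem) : Prop := in_NP (yes P) /\ NP_hard P.

(** * Graphs *)

Record graph := Graph {
  order : nat;
  adj : rel 'I_order;
  adj_sym : symmetric adj;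
  adj_irr : irreflexive adj
}.

Section GraphNotions.

Variable G : graph.
Local Notation V := 'I_(order G).

(* N(S) = N[S] \ S *)
Definition open_nbhd (S : {set V}) : {set V} :=
  [set v | v \notin S & [exists u in S, adj u v]].

Definition degree_in (S : {set V}) (v : V) : nat := #|[set u in S | adj v u]|.

Definition offensive_alliance (S : {set V}) : Prop :=
  S != set0 /\
  forall v, v \in open_nbhd S -> degree_in (~: S) v + 1 <= degree_in S v.

Definition independent (S : {set V}) : Prop :=
  forall u v, u \in S -> v \in S -> ~~ adj u v.

Definition clique (S : {set V}) : Prop :=
  forall u v, u \in S -> v \in S -> u != v -> adj u v.

Definition has_chord (c : seq V) : Prop :=
  exists u v, [/\ u \in c, v \in c, adj u v, v != next c u & u != next c v].

End GraphNotions.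

Definition any_graph (G : graph) : Prop := True.

Definition split_graph (G : graph) : Prop :=
  exists S : {set 'I_(order G)}, independent S /\ clique (~: S).

Definition chordal_graph (G : graph) : Prop :=
  forall c : seq 'I_(order G),
    ucycle (@adj G) c -> 4 <= size c -> has_chord c.

(** * The problem *)

Fixpoint pos_bits (p : BinNums.positive) : word :=
  match p with
  | BinNums.xH => [:: true]
  | BinNums.xO q => false :: pos_bits q
  | BinNums.xI q => true :: pos_bits q
  end.

(* Binary representation, least significant bit first. *)
Definition bits (n : nat) : word :=
  if bin_of_nat n is BinNums.Npos p then pos_bits p else [::].

(* The order in unary, closed by a 0; the adjacency matrix, row by row; r in
   binary. *)
Definition encode (G : graph) (r : nat) : word :=
  nseq (order G) true ++ false ::
  [seq adj i j | i <- enum 'I_(order G), j <- enum 'I_(order G)] ++ bits r.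

Definition OA_instance (C : graph -> Prop) : language := fun w =>
  exists (G : graph) (r : nat), [/\ C G, 1 <= r & w = encode G r].

Definition OA_yes (C : graph -> Prop) : language := fun w =>
  exists (G : graph) (r : nat),
    [/\ C G, 1 <= r, w = encode G r &
      exists S : {set 'I_(order G)},
        offensive_alliance S /\ 1 <= #|S| <= r].

Lemma OA_yes_instance (C : graph -> Prop) w : OA_yes C w -> OA_instance C w.
Proof. by case=> G [r [CG r_gt0 -> _]]; exists G, r. Qed.

(* Offensive Alliance restricted to the graphs of the class C. *)
Definition Offensive_Alliance (C : graph -> Prop) : problem :=
  Problem (@OA_yes_instance C).

(* Main.v *)
(* Membership in NP: the certificate of a graph consists of the alliance and, for
   split graphs, of the independent part; for chordal graphs it contains, for
   each vertex v and all non-adjacent neighbours a, b of v, a set that separates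
   a from b once v and its other neighbours are deleted.  Such sets exist for all
   v, a, b exactly when there is no chordless cycle of length at least four.

   Hardness: a verifier running for N steps yields a set system.  Its elements
   are the literals of the variables "column p of the configuration has value v
   at time t", its sets are the clauses of the Cook-Levin formula and the pairs
   of complementary literals, and the formula is satisfiable if and only if some
   hitting set has at most as many elements as there are variables.  A hitting
   set instance becomes a split graph: elements and a large set of heads form a
   clique, each set w is an independent vertex adjacent to its elements and to |w|
   heads, and many tails are adjacent to all heads.  A head outside of an
   alliance of bounded size would see too many tails, so the heads all belong to
   the alliance, and then the vertex w has a majority in the alliance if and only
   if one of its elements is there.

   Both the verifier and the reduction are functions whose output bits are given
   by expressions with loops over unary numbers of polynomial size, and these
   expressions are compiled to Turing machines. *)

From mathcomp Require Import all_boot zify.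
Require Import Defs.

Set Implicit Arguments.
Unset Strict Implicit.
Unset Printing Implicit Defensive.

(** * Structured programs for Turing machines *)

(** One reduction serves all three problems: its graphs are split, split graphs are chordal, and
    hardness passes to every class that contains the split graphs. Membership in NP differs from
    class to class, because a yes-word must encode a graph of the class and the verifier has to
    confirm this. The obstacle is that polynomial time means an explicit Turing machine. Expressions
    have a single loop, whose accumulator grows only by summands that do not depend on it; hence
    their values are polynomially bounded by construction, and so is the time of the compiled
    program. The radius can be exponential in the length of its binary notation, so the verifier
    replaces it by its minimum with the order of the graph. The formula never says that a column has
    only one value. The budget forces exactly one literal per variable, and the transition clauses
    then make every value of the run on the extracted certificate true; further true values do no
    harm, since the acceptance clauses only forbid values. *)

Section Programs.

Variable K : nat.
Local Notation sym := (symbol void).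
Local Notation tapes := {ffun 'I_K.+1 -> tape void}.
Local Notation view := {ffun 'I_K.+1 -> sym}.

Record prog := Prog {
  pstate : finType;
  pstart : pstate;
  pdelta : pstate -> view -> option pstate * ('I_K.+1 -> sym * direction)
}.

Definition pview (tp : tapes) : view := [ffun i => scanned (tp i)].

Definition pmove (tp : tapes) (act : 'I_K.+1 -> sym * direction) : tapes :=
  [ffun i => write_move (tp i) (act i)].

Definition pstep (p : prog) (c : option (pstate p) * tapes) :=
  if c.1 is Some q then
    let: (q', act) := pdelta q (pview c.2) in (q', pmove c.2 act)
  else c.

Definition runs (p : prog) (tp : tapes) (n : nat) (tp' : tapes) :=
  iter n (@pstep p) (Some (pstart p), tp) = (None, tp').

Lemma pstep_stable p n tp : iter n (@pstep p) (None, tp) = (None, tp).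
Proof. by elim: n => //= n ->. Qed.

Lemma runs_leq p tp m n tp' : m <= n -> runs p tp m tp' -> runs p tp n tp'.
Proof. by move=> le_mn; rewrite /runs -(subnK le_mn) iterD => ->; exact: pstep_stable. Qed.

(** A program that has exited idles, whereas the host moves on at once; so the exact exit time [m]
    has to be recovered from the bound [n]. *)
Lemma pstep_embed (p P : prog) (emb : pstate p -> pstate P) e :
  (forall q v, pdelta (emb q) v =
     (if (pdelta q v).1 is Some q' then Some (emb q') else e, (pdelta q v).2)) ->
  forall n q tp tp', iter n (@pstep p) (Some q, tp) = (None, tp') ->
  exists2 m, m <= n & iter m (@pstep P) (Some (emb q), tp) = (e, tp').
Proof.
move=> embE; elim=> [//|n IHn] q tp tp'.
rewrite iterSr {2}/pstep /=; case E: (pdelta q _) => [[q'|] act].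
  case/IHn=> m le_mn Em; exists m.+1 => //.
  by rewrite iterSr /pstep /= embE E /= Em.
rewrite pstep_stable => -[<-]; exists 1 => //.
by rewrite /= /pstep /= embE E.
Qed.

Definition keep (v : view) (i : 'I_K.+1) : sym * direction := (v i, Stay).

Definition skip : prog := Prog tt (fun _ v => (None, keep v)).

Definition pop (i : nat) : prog :=
  Prog tt (fun _ v => (None, fun j : 'I_K.+1 => (v j, if j == i :> nat then GoRight else Stay))).

(** The move to the left may uncover a leftover symbol, which the second step overwrites. *)
Definition push i (b : bool) : prog :=
  Prog true (fun q v =>
    if q then (Some false, fun j : 'I_K.+1 => (v j, if j == i :> nat then GoLeft else Stay))
    else (None, fun j : 'I_K.+1 => (if j == i :> nat then Some (inl b) else v j, Stay))).

Definition seqp (p1 p2 : prog) : prog :=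
  @Prog (pstate p1 + pstate p2)%type (inl (pstart p1)) (fun q v =>
    match q with
    | inl q => let: (q', act) := pdelta q v in
        (Some (if q' is Some q' then inl q' else inr (pstart p2)), act)
    | inr q => let: (q', act) := pdelta q v in (omap inr q', act)
    end).

Definition casep i (p0 p1 p2 : prog) : prog :=
  @Prog (option (pstate p0 + (pstate p1 + pstate p2)))%type None (fun q v =>
    match q with
    | None =>
        (Some (Some match v (inord i) with
          | Some (inl false) => inr (inl (pstart p1))
          | Some (inl true) => inr (inr (pstart p2))
          | _ => inl (pstart p0) end), keep v)
    | Some (inl q) => let: (q', act) := pdelta q v in (omap (Some \o inl) q', act)
    | Some (inr (inl q)) =>
        let: (q', act) := pdelta q v in (omap (Some \o inr \o inl) q', act)
    | Some (inr (inr q)) =>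
        let: (q', act) := pdelta q v in (omap (Some \o inr \o inr) q', act)
    end).

Definition whilep i (p : prog) : prog :=
  @Prog (option (pstate p)) None (fun q v =>
    if q is Some q then let: (q', act) := pdelta q v in (Some q', act)
    else (if v (inord i) is None then None else Some (Some (pstart p)), keep v)).

(* A store describes tape [i] as a stack of bits whose top is under the head;
   what lies to the left of the head is irrelevant. *)
Definition store := nat -> word.

(** Cells are compared one by one with the blank as default, since visited blank cells are listed
    explicitly in [rside]. *)
Definition holds (t : tape void) (w : word) :=
  forall k, nth None (rside t) k = nth None [seq Some (inl b) | b <- w] k.

Definition represents (tp : tapes) (s : store) := forall i, holds (tp i) (s i).

Variant does (p : prog) (s : store) (n : nat) (s' : store) : Prop :=
  Does of forall tp, represents tp s ->
    exists2 tp', runs p tp n tp' & represents tp' s'.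

Definition upd (s : store) i w : store := fun j => if j == i then w else s j.

Lemma does_ext p s1 s2 n s1' s2' :
  s1 =1 s2 -> s1' =1 s2' -> does p s1 n s1' -> does p s2 n s2'.
Proof.
move=> E E' [D]; split=> tp R; case: (D tp) => [i|tp' R1 R2]; first by rewrite E; exact: R.
by exists tp' => // i; rewrite -E'; exact: R2.
Qed.

Lemma does_leq p s m n s' : m <= n -> does p s m s' -> does p s n s'.
Proof. by move=> le_mn [D]; split=> tp /D[tp' R1 R2]; exists tp' => //; exact: runs_leq R1. Qed.

Lemma holds_stay t w : holds t w -> holds (write_move t (scanned t, Stay)) w.
Proof. by move=> H [|k]; rewrite -H /= /scanned; case: (rside t) => //=; rewrite nth_nil. Qed.

Lemma represents_keep tp s : represents tp s -> represents (pmove tp (keep (pview tp))) s.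
Proof. by move=> R i; rewrite ffunE /keep ffunE; apply: holds_stay. Qed.

Lemma does_skip s : does skip s 1 s.
Proof. by split=> tp R; exists (pmove tp (keep (pview tp))); [|apply: represents_keep]. Qed.

Lemma does_pop i s : does (pop i) s 1 (upd s i (behead (s i))).
Proof.
split=> tp R; eexists; first exact: erefl.
move=> j; rewrite ffunE ffunE /upd; case: eqP => [<-|_]; last exact: holds_stay.
by move=> k; rewrite /= nth_behead R -!nth_behead behead_map.
Qed.

Lemma does_push i b s : does (push i b) s 2 (upd s i (b :: s i)).
Proof.
split=> tp R; eexists; first exact: erefl.
move=> j; rewrite !ffunE /upd; case: eqP => [<-|_]; last by do 2!apply: holds_stay.
case=> [|k] //=; rewrite -(R j k) /scanned; case: (rside _) => //.
by case: k => //= k; rewrite nth_nil.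
Qed.

Lemma does_seq p1 p2 s n1 s1 n2 s2 :
  does p1 s n1 s1 -> does p2 s1 n2 s2 -> does (seqp p1 p2) s (n1 + n2) s2.
Proof.
move=> [D1] [D2]; split=> tp /D1[tp1 R1 /D2[tp2 R2 H]]; exists tp2 => //.
have [|m1 le1 E1] := @pstep_embed p1 (seqp p1 p2) inl (Some (inr (pstart p2))) _ _ _ _ _ R1.
  by move=> q v /=; case: (pdelta q v) => [[]].
have [|m2 le2 E2] := @pstep_embed p2 (seqp p1 p2) inr None _ _ _ _ _ R2.
  by move=> q v /=; case: (pdelta q v) => [[]].
apply: (@runs_leq _ _ (m2 + m1)); first by rewrite addnC leq_add.
by rewrite /runs iterD E1.
Qed.

Lemma view_top tp s i : i <= K -> represents tp s ->
  pview tp (inord i) = if s i is b :: _ then Some (inl b) else None.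
Proof.
move=> le_iK R; rewrite ffunE /scanned -nth0 R inordK //.
by case: (s i).
Qed.

Lemma does_case i p0 p1 p2 s n s' : i <= K ->
  does (if s i is b :: _ then if b then p2 else p1 else p0) s n s' ->
  does (casep i p0 p1 p2) s n.+1 s'.
Proof.
move=> le_iK [D]; split=> tp R.
have {D} := D _ (represents_keep R); case E: (s i) (view_top le_iK R) => [|[] w] vE [tp' R' H];
  exists tp' => //; rewrite /runs iterSr {2}/pstep /= vE.
- have [|m le_m Em] := @pstep_embed p0 (casep i p0 p1 p2) (Some \o inl) None _ _ _ _ _ R'.
    by move=> q v /=; case: (pdelta q v) => [[]].
  by rewrite -(subnK le_m) iterD Em; apply: (@pstep_stable (casep i p0 p1 p2)).
- have [|m le_m Em] := @pstep_embed p2 (casep i p0 p1 p2) (Some \o inr \o inr) None _ _ _ _ _ R'.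
    by move=> q v /=; case: (pdelta q v) => [[]].
  by rewrite -(subnK le_m) iterD Em; apply: (@pstep_stable (casep i p0 p1 p2)).
- have [|m le_m Em] := @pstep_embed p1 (casep i p0 p1 p2) (Some \o inr \o inl) None _ _ _ _ _ R'.
    by move=> q v /=; case: (pdelta q v) => [[]].
  by rewrite -(subnK le_m) iterD Em; apply: (@pstep_stable (casep i p0 p1 p2)).
Qed.

Lemma does_while_nil i p s : i <= K -> s i = [::] -> does (whilep i p) s 1 s.
Proof.
move=> le_iK s0; split=> tp R; exists (pmove tp (keep (pview tp))); last exact: represents_keep.
by rewrite /runs /= /pstep /= (view_top le_iK R) s0.
Qed.

Lemma does_while_cons i p s n s1 n' s' : i <= K -> s i != [::] ->
  does p s n s1 -> does (whilep i p) s1 n' s' -> does (whilep i p) s (n + n').+1 s'.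
Proof.
move=> le_iK s_n0 [D] [D']; split=> tp R.
have [tp1 R1 /D'[tp2 R2 H]] := D _ (represents_keep R); exists tp2 => //.
have [|m le_m Em] := @pstep_embed p (whilep i p) Some (Some None) _ _ _ _ _ R1.
  by move=> q v /=; case: (pdelta q v) => [[]].
apply: (@runs_leq _ _ (n' + m).+1); first by rewrite ltnS addnC leq_add2r.
rewrite /runs iterSr {2}/pstep /= (view_top le_iK R).
by case: (s i) s_n0 => // b w _; rewrite iterD Em.
Qed.

Lemma does_while i p (st : nat -> store) N n : i <= K ->
  (forall j, j < N -> st j i != [::]) -> st N i = [::] ->
  (forall j, j < N -> does p (st j) n (st j.+1)) ->
  does (whilep i p) (st 0) (N * n.+1).+1 (st N).
Proof.
move=> le_iK; elim: N st => [|N IHN] st st_n0 st_0 D.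
  exact: does_while_nil.
apply: (@does_leq _ _ (n + (N * n.+1).+1).+1); first lia.
apply: (does_while_cons (s1 := st 1)) => //; first exact: st_n0.
  exact: D.
by apply: (IHN (fun j => st j.+1)) => // j lt_jN; [apply: st_n0|apply: D].
Qed.

Definition clear i := whilep i (pop i).

Lemma does_clear i s n : i <= K -> size (s i) <= n -> does (clear i) s (n * 2).+1 (upd s i [::]).
Proof.
move=> le_iK le_n.
apply: (@does_leq _ _ (size (s i) * 2).+1); first by rewrite ltnS leq_mul2r le_n orbT.
pose st j := upd s i (drop j (s i)).
apply: (@does_ext _ (st 0) _ _ (st (size (s i)))) => [j|j|].
- by rewrite /st /upd drop0; case: eqP => // ->.
- by rewrite /st /upd drop_size.
apply: does_while => // [j lt_j||j lt_j].
- by rewrite /st /upd eqxx -size_eq0 size_drop subn_eq0 -ltnNge.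
- by rewrite /st /upd eqxx drop_size.
apply: (does_ext _ _ (does_pop i (st j))) => // k; rewrite /st /upd.
by case: eqP => //; rewrite eqxx -drop1 drop_drop add1n.
Qed.

Definition pour i j :=
  whilep i (casep i skip (seqp (pop i) (push j false)) (seqp (pop i) (push j true))).

Lemma does_pour i j s n : i <= K -> i != j -> size (s i) <= n ->
  does (pour i j) s (n * 5).+1 (upd (upd s i [::]) j (catrev (s i) (s j))).
Proof.
move=> le_iK ij le_n.
apply: (@does_leq _ _ (size (s i) * 5).+1); first by rewrite ltnS leq_mul2r le_n orbT.
pose st k := upd (upd s i (drop k (s i))) j (catrev (take k (s i)) (s j)).
apply: (@does_ext _ (st 0) _ _ (st (size (s i)))) => [k|k|].
- by rewrite /st /upd drop0 take0 /=; case: eqP => [->|_] //; case: eqP => [->|_] //.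
- by rewrite /st /upd drop_size take_size.
have stE k : st k i = drop k (s i) by rewrite /st /upd (negPf ij) eqxx.
apply: does_while => // [k lt_k||k lt_k].
- by rewrite stE -size_eq0 size_drop subn_eq0 -ltnNge.
- by rewrite stE drop_size.
apply: does_case => //; rewrite stE (drop_nth false) //.
have H b : nth false (s i) k = b -> does (seqp (pop i) (push j b)) (st k) 3 (st k.+1).
  move=> Eb; apply: (does_ext _ _ (does_seq (does_pop i _) (does_push j b _))) => // l.
  rewrite /upd (eq_sym j) (negPf ij) stE /st /upd eqxx (take_nth false) // Eb.
  rewrite !catrevE rev_rcons cat_cons.
  by case: eqP => // _; case: eqP => // _; rewrite -drop1 drop_drop add1n.
by case Eb: (nth _ _ _); apply: H.
Qed.

Lemma catrev_nseq n b (w : word) : catrev (nseq n b) w = nseq n b ++ w.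
Proof. by rewrite catrevE rev_nseq. Qed.

Definition fork i j k := whilep i (seqp (pop i) (seqp (push j true) (push k true))).

Lemma does_fork i j k s v n : i <= K -> uniq [:: i; j; k] -> s i = nseq v true -> v <= n ->
  does (fork i j k) s (n * 6).+1
    (upd (upd (upd s i [::]) j (nseq v true ++ s j)) k (nseq v true ++ s k)).
Proof.
move=> le_iK; rewrite /= !inE negb_or => /and3P[/andP[ij ik] jk _] si le_n.
apply: (@does_leq _ _ (v * 6).+1); first by rewrite ltnS leq_mul2r le_n orbT.
pose st l := upd (upd (upd s i (nseq (v - l) true)) j (nseq l true ++ s j)) k (nseq l true ++ s k).
have stE l : st l i = nseq (v - l) true by rewrite /st /upd (negPf ij) (negPf ik) eqxx.
apply: (@does_ext _ (st 0) _ _ (st v)) => [l|l|].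
- by rewrite /st /upd subn0 -si /=; case: eqP => [->|_] //; case: eqP => [->|_] //; case: eqP => [->|_] //.
- by rewrite /st /upd subnn.
apply: does_while => // [l lt_l||l lt_l].
- by rewrite stE; case: (v - l) (subn_gt0 l v) lt_l => // <-.
- by rewrite stE subnn.
apply: (does_ext _ _ (does_seq (does_pop i (st l))
  (does_seq (does_push j true _) (does_push k true _)))) => // m.
rewrite {1}/upd; case: eqP => [->|/eqP mk].
  by rewrite /upd eq_sym (negPf jk) eq_sym (negPf ik) /st /upd eqxx.
rewrite {1}/upd; case: eqP => [->|/eqP mj].
  by rewrite /upd eq_sym (negPf ij) /st /upd (negPf jk) eqxx.
rewrite {1}/upd; case: eqP => [->|/eqP mi].
  by rewrite !stE subnS; case: (v - l).
by rewrite /st /upd (negPf mk) (negPf mj) (negPf mi).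
Qed.

(** Reading a stack empties it, so a second copy is made and poured back; the reversal by [pour] is
    invisible on unary numbers. *)
Definition copy i j k := seqp (fork i j k) (pour k i).

Lemma does_copy i j k s v n : i <= K -> k <= K -> uniq [:: i; j; k] ->
  s i = nseq v true -> s k = [::] -> v <= n ->
  does (copy i j k) s (n * 11 + 2) (upd s j (nseq v true ++ s j)).
Proof.
move=> le_iK le_kK U si sk le_n; move: (U).
rewrite /= !inE negb_or => /and3P[/andP[ij ik] jk _].
apply: does_leq (_ : (n * 6).+1 + (n * 5).+1 <= _) _; first lia.
have F := does_fork le_iK U si le_n.
apply: (does_ext _ _ (does_seq F (does_pour (n := n) le_kK _ _))) => //.
- move=> m; rewrite {1}/upd; case: eqP => [->|/eqP mi].
    rewrite /upd eqxx (negPf ij) (negPf ik) eqxx si sk cats0 catrev_nseq cats0.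
    by rewrite eq_sym in ij.
  rewrite {1}/upd; case: eqP => [->|/eqP mk].
    by rewrite /upd eq_sym (negPf jk).
  by rewrite /upd (negPf mi) (negPf mk).
- by rewrite eq_sym.
- by rewrite /upd eqxx sk cats0 size_nseq.
Qed.

(** Popping an empty stack leaves it empty, which is the truncation of subtraction at 0. *)
Definition monus i j := whilep j (seqp (pop j) (pop i)).

Lemma does_monus i j s v w n : j <= K -> i != j ->
  s i = nseq v true -> s j = nseq w true -> w <= n ->
  does (monus i j) s (n * 3).+1 (upd (upd s j [::]) i (nseq (v - w) true)).
Proof.
move=> le_jK ij si sj le_n.
apply: (@does_leq _ _ (w * 3).+1); first by rewrite ltnS leq_mul2r le_n orbT.
pose st l := upd (upd s j (nseq (w - l) true)) i (nseq (v - l) true).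
have stE l : st l j = nseq (w - l) true by rewrite /st /upd eq_sym (negPf ij) eqxx.
apply: (@does_ext _ (st 0) _ _ (st w)) => [l|l|].
- by rewrite /st /upd !subn0 -si -sj; case: eqP => [->|_] //; case: eqP => [->|_] //.
- by rewrite /st /upd subnn.
apply: does_while => // [l lt_l||l lt_l].
- by rewrite stE; case: (w - l) (subn_gt0 l w) lt_l => // <-.
- by rewrite stE subnn.
apply: (does_ext _ _ (does_seq (does_pop j (st l)) (does_pop i _))) => // m.
rewrite {1}/upd; case: eqP => [->|/eqP mi].
  by rewrite /upd (negPf ij) /st /upd eqxx subnS; case: (v - l).
rewrite {1}/upd; case: eqP => [->|/eqP mj].
  by rewrite !stE subnS; case: (w - l).
by rewrite /st /upd (negPf mj) (negPf mi).
Qed.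

Lemma holds_read_bits t w : holds t w -> read_bits (rside t) = w.
Proof.
rewrite /holds; elim: w (rside t) => [|b w IHw] [|a r] H //; try by have := H 0.
- by have /= := H 0 => ->.
- by have /= -> := H 0; rewrite (IHw r) // => k; have := H k.+1.
Qed.

Definition machine_of (p : prog) : machine :=
  @Machine K void (option (pstate p)) (Some (pstart p)) (fun q => ~~ isSome q)
    (fun q v => if q is Some q then pdelta q v else (None, keep v)).

Lemma does_outputs p ws n s' :
  does p (fun i => nth [::] ws i) n s' -> outputs_within (machine_of p) ws n (s' 0).
Proof.
case=> D; pose tp := (initial (machine_of p) ws).2.
have [|tp' R H] := D tp; first by move=> i k; rewrite ffunE.
have E c : step (M := machine_of p) c = pstep c by case: c => [[q|] tpq].
have {}R : iter n (@step (machine_of p)) (initial (machine_of p) ws) = (None, tp').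
  by rewrite -R (eq_iter E).
by rewrite /outputs_within R; split=> //; apply: holds_read_bits (H ord0).
Qed.

End Programs.

(** * Expressions over unary numbers and their compilation *)

(** The base is at least 2 even for [n = 0], so constants are absorbed by the exponent and closure
    under sums, products and composition needs no coefficients. *)
Definition poly_bounded (f : nat -> nat) := exists k, forall n, f n <= (n + 2) ^ k.

Lemma poly_const c : poly_bounded (fun _ => c).
Proof.
exists c => n; apply: leq_trans (_ : 2 ^ c <= _); first exact: ltnW (ltn_expl _ _).
by case: c => // c; rewrite leq_exp2r // addnC leq_addr.
Qed.

Lemma poly_id : poly_bounded id.
Proof. by exists 1 => n; rewrite expn1 leq_addr. Qed.

Lemma poly_mul f g : poly_bounded f -> poly_bounded g -> poly_bounded (fun n => f n * g n).
Proof. by case=> k Hf [l Hg]; exists (k + l) => n; rewrite expnD leq_mul. Qed.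

Lemma poly_add f g : poly_bounded f -> poly_bounded g -> poly_bounded (fun n => f n + g n).
Proof.
case=> k Hf [l Hg]; exists (k + l).+1 => n.
have k_gt0 : 0 < (n + 2) ^ k by rewrite expn_gt0 addn2.
have l_gt0 : 0 < (n + 2) ^ l by rewrite expn_gt0 addn2.
have {}Hf := Hf n; have {}Hg := Hg n; rewrite expnS expnD; nia.
Qed.

Lemma poly_comp f g : poly_bounded f -> poly_bounded g -> poly_bounded (fun n => f (g n)).
Proof.
case=> k Hf [l Hg]; exists (l.+2 * k) => n; apply: leq_trans (Hf _) _.
case: k {Hf} => [|k]; first by rewrite muln0.
rewrite expnM leq_exp2r //; have {}Hg := Hg n.
have l_gt0 : 0 < (n + 2) ^ l by rewrite expn_gt0 addn2.
rewrite !expnS; nia.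
Qed.

Lemma poly_bounded_standard f : poly_bounded f -> exists c k, forall n, f n <= c * n ^ k + c.
Proof.
(* For positive [n] one has [n + 2 <= 3 * n]; the additive constant covers [n = 0]. *)
case=> k Hf; exists (3 ^ k), k => n; apply: leq_trans (Hf n) _.
have le_exp a b : a <= b -> a ^ k <= b ^ k by case: k {Hf} => // k; rewrite leq_exp2r.
case: n => [|n]; first by apply: leq_trans (leq_addl _ _); apply: le_exp.
by rewrite -expnMn; apply: leq_trans (leq_addr _ _); apply: le_exp; lia.
Qed.

(** The summand [p] does not see the accumulator, which bounds the growth; the subtrahend [m] does,
    which is enough to express every recursion whose values stay below a known bound. *)
Fixpoint loop (n : nat) (p : nat -> nat) (m : nat -> nat -> nat) : nat :=
  if n is n'.+1 then let a := loop n' p m + p n' in a - m n' a else 0.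

Definition push_env a (v : nat -> nat) i := if i is j.+1 then v j else a.

Inductive expr :=
| Var of nat
| One
| Add of expr & expr
| Sub of expr & expr
| Loop of expr & expr & expr
| Bit of bool & expr
| Len of bool.

Definition letter (w : word) i : nat := nth false w i.

Section Eval.

Variables x y : word.

Local Notation input b := (if b then y else x).

(* In the third argument of [Loop], variable 0 is the accumulator and variable
   1 the loop index. *)
Fixpoint eval (e : expr) (v : nat -> nat) : nat :=
  match e with
  | Var i => v i
  | One => 1
  | Add e1 e2 => eval e1 v + eval e2 v
  | Sub e1 e2 => eval e1 v - eval e2 v
  | Loop e1 e2 e3 => loop (eval e1 v) (fun i => eval e2 (push_env i v))
                       (fun i a => eval e3 (push_env a (push_env i v)))
  | Bit b e => letter (input b) (eval e v)
  | Len b => size (input b)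
  end.

Lemma eq_loop n p m p' m' : p =1 p' -> m =2 m' -> loop n p m = loop n p' m'.
Proof. by move=> Ep Em; elim: n => //= n ->; rewrite Ep Em. Qed.

Lemma loop_leq n p m c : (forall i, i < n -> p i <= c) -> loop n p m <= n * c.
Proof.
elim: n => //= n IHn H; apply: leq_trans (leq_subr _ _) _.
by rewrite mulSn addnC leq_add ?H ?IHn // => i lt_in; rewrite H // ltnW.
Qed.

(** A loop is bounded by its number of rounds times the largest summand, as its third argument can
    only subtract. *)
Fixpoint vbound e N : nat :=
  match e with
  | Var _ | Len _ => N
  | One | Bit _ _ => 1
  | Add e1 e2 => vbound e1 N + vbound e2 N
  | Sub e1 e2 => vbound e1 N
  | Loop e1 e2 e3 => vbound e1 N * vbound e2 (N + vbound e1 N)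
  end.

Lemma eval_leq e v N : size x <= N -> size y <= N -> (forall i, v i <= N) ->
  eval e v <= vbound e N.
Proof.
elim: e v N => [i||e1 IH1 e2 IH2|e1 IH1 e2 IH2|e1 IH1 e2 IH2 e3 _|b e _|b] //= v N xN yN vN.
- by rewrite leq_add ?IH1 ?IH2.
- by apply: leq_trans (leq_subr _ _) _; apply: IH1.
- have le1 := IH1 v N xN yN vN.
  apply: leq_trans (loop_leq (c := vbound e2 (N + vbound e1 N)) _ _) _ => [i lt_i|].
    by apply: IH2 => [||[|j]] //=; first [lia | have := vN j; lia].
  by rewrite leq_mul2r le1 orbT.
- exact: leq_b1.
- by case: b.
Qed.

End Eval.

Lemma poly_vbound e : poly_bounded (vbound e).
Proof.
elim: e => [i||e1 IH1 e2 IH2|e1 IH1 e2 IH2|e1 IH1 e2 IH2 e3 _|b e _|b] //=; try exact: poly_id.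
- exact: (poly_const 1).
- exact: poly_add.
- apply: poly_mul => //; apply: (poly_comp (f := vbound e2)) => //.
  exact: poly_add poly_id _.
- exact: (poly_const 1).
Qed.

Ltac store_cases :=
  rewrite /upd; repeat (case: eqP => ?; try lia); subst; try done.

(** * Compilation of expressions to stack programs *)

Section Compilation.

Variable K : nat.

(* Variable [i] is held in unary by stack [r i]; the value is left in stack [d],
   and the stacks from [d] on are initially empty. *)
Fixpoint compile (e : expr) (r : nat -> nat) (d : nat) : prog K :=
  match e with
  | Var i => copy K (r i) d d.+1
  | One => push K d true
  | Add e1 e2 => seqp (compile e1 r d) (seqp (compile e2 r d.+1) (pour K d.+1 d))
  | Sub e1 e2 => seqp (compile e1 r d) (seqp (compile e2 r d.+1) (monus K d d.+1))
  | Loop e1 e2 e3 =>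
      seqp (compile e1 r d)
     (seqp (whilep d
              (seqp (pop K d)
              (seqp (compile e2 (push_env d.+1 r) d.+3)
              (seqp (pour K d.+3 d.+2)
              (seqp (compile e3 (push_env d.+2 (push_env d.+1 r)) d.+3)
              (seqp (monus K d.+2 d.+3) (push K d.+1 true)))))))
     (seqp (pour K d.+2 d) (clear K d.+1)))
  | Bit b e =>
      let i : nat := b in
      seqp (compile e r d.+1)
     (seqp (whilep d.+1
              (seqp (pop K d.+1)
                 (casep i (skip K) (seqp (pop K i) (push K d.+2 false))
                                 (seqp (pop K i) (push K d.+2 true)))))
     (seqp (casep i (skip K) (skip K) (push K d true))
           (pour K d.+2 i)))
  | Len b =>
      let i : nat := b in
      seqp (whilep i
              (seqp (casep i (skip K) (push K d.+1 false) (push K d.+1 true))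
              (seqp (pop K i) (push K d true))))
           (pour K d.+1 i)
  end.

Fixpoint stacks e : nat :=
  match e with
  | Var _ | Len _ | One => 2
  | Add e1 e2 | Sub e1 e2 => stacks e1 + stacks e2 + 2
  | Loop e1 e2 e3 => stacks e1 + stacks e2 + stacks e3 + 4
  | Bit _ e => stacks e + 4
  end.

(** [N3] bounds the accumulator after an addition and before the matching subtraction, which is the
    value that the third argument of a loop reads. *)
Fixpoint time e N : nat :=
  match e with
  | Var _ => N * 11 + 2
  | One => 2
  | Add e1 e2 => time e1 N + (time e2 N + (vbound e2 N * 5 + 1))
  | Sub e1 e2 => time e1 N + (time e2 N + (vbound e2 N * 3 + 1))
  | Loop e1 e2 e3 =>
      let n := vbound e1 N in
      let v := vbound e2 (N + n) in
      let N3 := N + n + (n + 1) * v in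
      time e1 N +
      (n * (time e2 (N + n) + (v * 5 + 1) + time e3 N3 + (vbound e3 N3 * 3 + 1) + 4) + 1 +
      (n * v * 5 + 1 + (n * 2 + 1)))
  | Bit _ e => time e N + (vbound e N * 6 + 1 + (3 + (vbound e N * 5 + 1)))
  | Len _ => N * 7 + 1 + (N * 5 + 1)
  end.

Lemma poly_time e : poly_bounded (time e).
Proof.
have cst c : poly_bounded (fun _ => c) by exact: poly_const.
have Pb := poly_vbound.
elim: e => [i||e1 IH1 e2 IH2|e1 IH1 e2 IH2|e1 IH1 e2 IH2 e3 IH3|b e IH|b] //=;
  do !first [exact: poly_id|exact: cst|exact: Pb|by []|apply: poly_add|apply: poly_mul
    |apply: (poly_comp (f := time e2))|apply: (poly_comp (f := time e3))
    |apply: (poly_comp (f := vbound e2))|apply: (poly_comp (f := vbound e3))].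
Qed.

Definition ready x y v (r : nat -> nat) d (s : store) :=
  [/\ s 0 = x, s 1 = y, 1 < d, forall i, s (r i) = nseq (v i) true /\ r i < d
    & forall i, d <= i -> s i = [::]].

Lemma ready_above x y v r d s d' s' : ready x y v r d s -> d <= d' ->
  (forall i, i < d -> s' i = s i) -> (forall i, d' <= i -> s' i = [::]) ->
  ready x y v r d' s'.
Proof.
case=> s0 s1 d_gt1 rP _ le_d eq_s s'0; split=> //; try by rewrite eq_s // ltnW.
- exact: leq_trans le_d.
- by move=> i; have [sr lt_r] := rP i; rewrite eq_s // sr (leq_trans lt_r le_d).
Qed.

Lemma ready_push x y v r d s j a : ready x y v r d s -> j < d -> s j = nseq a true ->
  ready x y (push_env a v) (push_env j r) d s.
Proof. by case=> s0 s1 d_gt1 rP s_d lt_j sj; split=> // -[|i] //=; apply: rP. Qed.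

(** Only stack [d] changes: inputs are restored and scratch stacks are emptied, so an expression can
    be evaluated again in every round of a loop. *)
Lemma compile_ok x y e v r d s N :
  ready x y v r d s -> d + stacks e <= K -> size x <= N -> size y <= N ->
  (forall i, v i <= N) ->
  does (compile e r d) s (time e N) (upd s d (nseq (eval x y e v) true)).
Proof.
elim: e v r d s N => [i||e1 IH1 e2 IH2|e1 IH1 e2 IH2|e1 IH1 e2 IH2 e3 IH3|b e IH|b] v r d s N /=
  rdy leK xN yN vN; have [s0 s1 d_gt1 rP s_d] := rdy.
- have [sr lt_r] := rP i.
  apply: (does_ext _ _ (does_copy (v := v i) _ _ _ sr _ _)) => //; try lia.
  + by move=> k; rewrite s_d // cats0.
  + rewrite /= !inE; lia.
  + by rewrite s_d.
- by apply: (does_ext _ _ (does_push K d true s)) => // k; rewrite s_d.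
- have le2 := eval_leq e2 xN yN vN.
  have D1 := IH1 _ _ _ _ _ rdy (leq_trans _ leK) xN yN vN.
  have R2 : ready x y v r d.+1 (upd s d (nseq (eval x y e1 v) true)).
    by apply: ready_above rdy _ _ _ => // i ?; store_cases; rewrite s_d //; lia.
  have D2 := IH2 _ _ _ _ _ R2 _ xN yN vN.
  have D3 : does (pour K d.+1 d) _ _ _ := does_pour (n := vbound e2 N)
    (s := upd (upd s d (nseq (eval x y e1 v) true)) d.+1 (nseq (eval x y e2 v) true)) _ _ _.
  apply: (does_ext _ _ (does_leq _ (does_seq (D1 _) (does_seq (D2 _) (D3 _ _ _))))) => //; try lia.
  + move=> k; store_cases; last by rewrite s_d //; lia.
    by rewrite catrev_nseq addnC nseqD.
  + by rewrite /upd eqxx size_nseq.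
- have le2 := eval_leq e2 xN yN vN.
  have D1 := IH1 _ _ _ _ _ rdy (leq_trans _ leK) xN yN vN.
  have R2 : ready x y v r d.+1 (upd s d (nseq (eval x y e1 v) true)).
    by apply: ready_above rdy _ _ _ => // i ?; store_cases; rewrite s_d //; lia.
  have D2 := IH2 _ _ _ _ _ R2 _ xN yN vN.
  have D3 : does (monus K d d.+1) _ _ _ := does_monus (n := vbound e2 N)
    (s := upd (upd s d (nseq (eval x y e1 v) true)) d.+1 (nseq (eval x y e2 v) true))
    (v := eval x y e1 v) (w := eval x y e2 v) _ _ _ _ _.
  apply: (does_ext _ _ (does_leq _ (does_seq (D1 _) (does_seq (D2 _) (D3 _ _ _ _ _))))) => //;
    try lia; try by store_cases.
  by move=> k; store_cases; rewrite s_d //; lia.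
- set n' := vbound e1 N; set V2 := vbound e2 (N + n'); set N3 := N + n' + (n' + 1) * V2.
  set n := eval x y e1 v; set p := fun i => _ : nat; set m := fun i a => _ : nat.
  have le_n : n <= n' by exact: eval_leq.
  have le_p i : i < n -> p i <= V2.
    by move=> lt_i; apply: eval_leq => [||[|j]] //=; first [lia | have := vN j; lia].
  have le_acc i : i <= n -> loop i p m <= i * V2.
    by move=> le_i; apply: loop_leq => j lt_j; apply: le_p; exact: leq_trans le_i.
  have le_acc' i : i < n -> loop i p m + p i <= N3.
    move=> lt_i; have := le_acc i (ltnW lt_i); have := le_p i lt_i.
    by rewrite /N3; nia.
  (* Stack [d] holds the remaining rounds, [d.+1] the loop index, [d.+2] the accumulator and [d.+3]
     the value of the current subexpression. *)
  pose st a b c e := upd (upd (upd (upd s d (nseq a true)) d.+1 (nseq b true))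
    d.+2 (nseq c true)) d.+3 (nseq e true).
  have R a b c : ready x y v r d.+3 (st a b c 0).
    apply: ready_above rdy _ _ _ => [|i ?|i ?]; first lia; rewrite /st; store_cases.
    by rewrite s_d //; lia.
  have D1 : does (compile e1 r d) s (time e1 N) (st n 0 0 0).
    apply: (does_ext _ _ (IH1 _ _ _ _ _ rdy (leq_trans _ leK) xN yN vN)) => //; last by lia.
    by move=> k; rewrite /st /n; store_cases; rewrite s_d //; lia.
  set body := (seqp (pop K d) _).
  set c := time e2 (N + n') + (V2 * 5 + 1) + time e3 N3 + (vbound e3 N3 * 3 + 1) + 3.
  have Dbody i : i < n ->
      does body (st (n - i) i (loop i p m) 0) c (st (n - i.+1) i.+1 (loop i.+1 p m) 0).
    move=> lt_i; have vN' j : push_env i v j <= N + n'.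
      by case: j => [|j] /=; [lia|have := vN j; lia].
    set a := loop i p m + p i.
    have aN : a <= N3 by exact: le_acc'.
    have vN3 j : push_env a (push_env i v) j <= N3.
      by case: j => [|j] //=; have := vN' j; rewrite /N3; nia.
    have R2 f g : ready x y (push_env i v) (push_env d.+1 r) d.+3 (st f i g 0).
      by apply: ready_push (R _ _ _) _ _; [lia|rewrite /st; store_cases].
    have R3 f : ready x y (push_env a (push_env i v)) (push_env d.+2 (push_env d.+1 r)) d.+3
        (st f i a 0).
      by apply: ready_push (R2 _ _) _ _; [lia|rewrite /st; store_cases].
    set n1 := n - i.+1.
    have E1 : does (pop K d) (st (n - i) i (loop i p m) 0) 1 (st n1 i (loop i p m) 0).
      apply: (does_ext _ _ (does_pop K d _)) => [k|k]; first by [].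
      by rewrite /st; store_cases; rewrite -subnSK.
    have E2 : does (compile e2 (push_env d.+1 r) d.+3) (st n1 i (loop i p m) 0)
        (time e2 (N + n')) (st n1 i (loop i p m) (p i)).
      apply: (does_ext _ _ (IH2 _ _ _ _ _ (R2 _ _) _ _ _ vN')) => //; try lia.
      by move=> k; rewrite /st /p; store_cases.
    have E3 : does (pour K d.+3 d.+2) (st n1 i (loop i p m) (p i)) (V2 * 5).+1 (st n1 i a 0).
      apply: (does_ext _ _ (does_pour _ _ _)); try lia; first by [].
        move=> k; rewrite /st; store_cases.
        by rewrite catrev_nseq /a addnC nseqD.
      by rewrite /st; store_cases; rewrite size_nseq le_p.
    have E4 : does (compile e3 (push_env d.+2 (push_env d.+1 r)) d.+3) (st n1 i a 0)
        (time e3 N3) (st n1 i a (m i a)).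
      apply: (does_ext _ _ (IH3 _ _ _ _ _ (R3 _) _ _ _ vN3)) => //; try (rewrite /N3; lia).
      by move=> k; rewrite /st /m; store_cases.
    have E5 : does (monus K d.+2 d.+3) (st n1 i a (m i a)) (vbound e3 N3 * 3).+1
        (st n1 i (a - m i a) 0).
      apply: (does_ext _ _ (does_monus (v := a) (w := m i a) _ _ _ _ _)); try lia; first by [].
      - by move=> k; rewrite /st; store_cases.
      - by rewrite /st; store_cases.
      - by rewrite /st; store_cases.
      - by apply: eval_leq => //; rewrite /N3; lia.
    have E6 : does (push K d.+1 true) (st n1 i (a - m i a) 0) 2 (st n1 i.+1 (a - m i a) 0).
      apply: (does_ext _ _ (does_push K d.+1 true _)) => [k|k]; first by [].
      by rewrite /st; store_cases.
    apply: does_leq _ (does_seq E1 (does_seq E2 (does_seq E3 (does_seq E4 (does_seq E5 E6))))).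
    by rewrite /c; lia.
  have Dloop : does (whilep d body) (st n 0 0 0) (n' * c.+1).+1 (st 0 n (loop n p m) 0).
    apply: (@does_leq _ _ _ (n * c.+1).+1); first by rewrite ltnS leq_mul2r le_n orbT.
    have := does_while (K := K) (i := d) (p := body) (N := n) (n := c)
      (st := fun i => st (n - i) i (loop i p m) 0).
    rewrite subn0 subnn; apply=> //; first lia.
    - move=> j lt_j; have -> : st (n - j) j (loop j p m) 0 d = nseq (n - j) true.
        by rewrite /st; store_cases.
      by rewrite -size_eq0 size_nseq; lia.
    - by rewrite /st; store_cases.
  have D4 : does (pour K d.+2 d) (st 0 n (loop n p m) 0) (n' * V2 * 5).+1 (st (loop n p m) n 0 0).
    apply: (does_ext _ _ (does_pour _ _ _)); try lia; first by [].
      by move=> k; rewrite /st; store_cases; rewrite catrev_nseq cats0.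
    rewrite /st; store_cases; rewrite size_nseq; apply: leq_trans (le_acc _ _) _ => //.
    by rewrite leq_mul2r le_n orbT.
  have D5 : does (clear K d.+1) (st (loop n p m) n 0 0) (n' * 2).+1 (st (loop n p m) 0 0 0).
    apply: (does_ext _ _ (does_clear _ _)); try lia; first by [].
      by move=> k; rewrite /st; store_cases.
    by rewrite /st; store_cases; rewrite size_nseq.
  apply: (does_ext _ _ (does_leq _ (does_seq D1 (does_seq Dloop (does_seq D4 D5))))) => //.
  + by move=> k; rewrite /st; store_cases; rewrite s_d //; lia.
  + by rewrite /c; nia.
- set i : nat := b; set n := eval x y e v; set w := if b then y else x.
  have le_n : n <= vbound e N by exact: eval_leq.
  have i_lt : i < d by rewrite /i; case: b {w i}; lia.
  have si : s i = w by rewrite /i /w; case: b {w i i_lt}.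
  (* After [j] rounds the first [j] letters lie reversed on stack [d.+2], from where they are poured
     back after the next letter has been inspected; [o] is the answer. *)
  pose st j (o : nat) := upd (upd (upd (upd s d.+1 (nseq (n - j) true)) i (drop j w))
    d.+2 (rev (take j w))) d (nseq o true).
  have D1 : does (compile e r d.+1) s (time e N) (st 0 0).
    have R : ready x y v r d.+1 s.
      by apply: ready_above rdy _ _ _ => // k ?; rewrite s_d //; lia.
    apply: (does_ext _ _ (IH _ _ _ _ _ R _ xN yN vN)) => //; last by lia.
    by move=> k; rewrite /st subn0 drop0 take0; store_cases; rewrite s_d //; lia.
  set body := seqp (pop K d.+1) _.
  have Dbody j : j < n -> does body (st j 0) 5 (st j.+1 0).
    move=> lt_j; apply: (does_seq (n1 := 1) (n2 := 4) (does_pop K d.+1 _)).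
    apply: does_case; first lia.
    have -> : upd (st j 0) d.+1 (behead (st j 0 d.+1)) i = drop j w.
      by rewrite /st; store_cases; lia.
    have E := size_drop j w.
    case Ew: (drop j w) E => [|b' w'] /= E.
      apply: does_leq _ (does_ext _ _ (does_skip K _)) => // k; rewrite /st.
      have -> : drop j.+1 w = [::] by apply/drop_oversize; lia.
      rewrite Ew !take_oversize; try lia.
      by store_cases; rewrite -subnSK.
    have Dpush : does (seqp (pop K i) (push K d.+2 b'))
        (upd (st j 0) d.+1 (behead (st j 0 d.+1))) 3 (st j.+1 0).
      apply: (does_ext _ _ (does_seq (does_pop K i _) (does_push K d.+2 b' _))) => // k.
      have lt_jw : j < size w by lia.
      have Ed : drop j.+1 w = w' by rewrite -add1n -drop_drop Ew /= drop0.
      rewrite /st (take_nth false) // rev_rcons Ew Ed.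
      have -> : nth false w j = b' by rewrite -[j]addn0 -nth_drop Ew.
      by store_cases; rewrite -subnSK.
    by case: b' Dpush {Ew}.
  have Dloop : does (whilep d.+1 body) (st 0 0) (vbound e N * 6).+1 (st n 0).
    apply: (@does_leq _ _ _ (n * 6).+1); first by rewrite ltnS leq_mul2r le_n orbT.
    apply: (does_while (st := fun j => st j 0)) => //; first lia.
    - move=> j lt_j; have -> : st j 0 d.+1 = nseq (n - j) true.
        by rewrite /st; store_cases; lia.
      by rewrite -size_eq0 size_nseq; lia.
    - by rewrite /st subnn; store_cases; lia.
  have D2 : does (casep i (skip K) (skip K) (push K d true)) (st n 0) 3 (st n (letter w n)).
    apply: does_case; first lia.
    have -> : st n 0 i = drop n w by rewrite /st; store_cases; lia.
    case Ew: (drop n w) => [|[] w'] /=.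
    - rewrite /letter nth_default; first exact: does_leq _ (does_skip K _).
      by rewrite leqNgt -subn_gt0 -size_drop Ew.
    - rewrite /letter -[n in nth _ _ n]addn0 -nth_drop Ew /=.
      apply: (does_ext _ _ (does_push K d true _)) => [k|k]; first by [].
      by rewrite /st; store_cases.
    - rewrite /letter -[n in nth _ _ n]addn0 -nth_drop Ew /=.
      exact: does_leq _ (does_skip K _).
  have D3 : does (pour K d.+2 i) (st n (letter w n)) (vbound e N * 5).+1
      (upd s d (nseq (letter w n) true)).
    apply: (does_ext _ _ (does_pour _ _ _)); try lia; first by [].
    - move=> k; rewrite /st subnn; store_cases; try lia; try by rewrite s_d //; lia.
      by rewrite catrevE revK cat_take_drop.
    - have -> : st n (letter w n) d.+2 = rev (take n w) by rewrite /st; store_cases.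
      by rewrite size_rev size_take_min; lia.
  by apply: does_leq _ (does_seq D1 (does_seq Dloop (does_seq D2 D3))); lia.
- set i : nat := b; set w := if b then y else x.
  have wN : size w <= N by rewrite /w; case: b {i w}.
  have i_lt : i < d by rewrite /i; case: b {w i wN}; lia.
  have si : s i = w by rewrite /i /w; case: b {w i i_lt wN}.
  pose st j := upd (upd (upd s i (drop j w)) d.+1 (rev (take j w))) d (nseq j true).
  have sti j : st j i = drop j w by rewrite /st; store_cases; lia.
  set body := seqp (casep i _ _ _) _.
  have Dbody j : j < size w -> does body (st j) 6 (st j.+1).
    move=> lt_j; have Ew := drop_nth false lt_j.
    have E1 : does (casep i (skip K) (push K d.+1 false) (push K d.+1 true)) (st j) 3
        (upd (st j) d.+1 (rev (take j.+1 w))).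
      apply: does_case; first lia.
      rewrite sti Ew (take_nth false) // rev_rcons.
      have -> : rev (take j w) = st j d.+1 by rewrite /st; store_cases; lia.
      by case: (nth _ _ _); apply: does_push.
    apply: (does_ext _ _ (does_seq E1 (does_seq (does_pop K i _) (does_push K d true _)))) => // k.
    set S := upd (st j) d.+1 _; have -> : S i = nth false w j :: drop j.+1 w.
      by rewrite -Ew -sti /S /upd ifN //; lia.
    by rewrite /S /st; store_cases.
  have Dloop : does (whilep i body) (st 0) (N * 7).+1 (st (size w)).
    apply: (@does_leq _ _ _ (size w * 7).+1); first by rewrite ltnS leq_mul2r wN orbT.
    apply: does_while => //; first lia.
    - by move=> j lt_j; rewrite sti -size_eq0 size_drop subn_eq0 -ltnNge.
    - by rewrite sti drop_size.
  have D3 : does (pour K d.+1 i) (st (size w)) (N * 5).+1 (upd s d (nseq (size w) true)).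
    apply: (does_ext _ _ (does_pour _ _ _)); try lia; first by [].
    - move=> k; rewrite /st take_size drop_size; store_cases; try lia; try by rewrite s_d //; lia.
      by rewrite catrevE revK cats0.
    - have -> : st (size w) d.+1 = rev (take (size w) w) by rewrite /st; store_cases; lia.
      by rewrite take_size size_rev.
  apply: (does_ext _ _ (does_leq _ (does_seq Dloop D3))) => //; last by lia.
  by move=> k; rewrite /st drop0 take0; store_cases; rewrite s_d.
Qed.

End Compilation.

(** * Polynomial-time machines from definable functions *)

Definition env := nat -> nat.

Definition definable (f : word -> word -> env -> nat) :=
  exists e, forall x y v, eval x y e v = f x y v.

(** All variables share tape 2, which is empty at the start, so each of them has value 0. *)
Lemma ready_start x y : ready x y (fun _ => 0) (fun _ => 2) 3 (fun i => nth [::] [:: x; y] i).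
Proof. by split=> // [[|[|[|i]]]]. Qed.

Lemma definable_polytime_relation (V : word -> word -> bool) :
  definable (fun x y _ => V x y) -> polytime_relation V.
Proof.
case=> e He; pose K := 3 + stacks e.
pose p := seqp (compile K e (fun _ => 2) 3) (seqp (clear K 0)
  (casep 3 (push K 0 false) (skip K) (push K 0 true))).
pose T N := time e N + ((N * 2 + 1) + 3).
have [c [k HT]] : exists c k, forall n, T n <= c * n ^ k + c.
  apply: poly_bounded_standard; apply: poly_add (poly_time e) _.
  apply: poly_add; last exact: poly_const.
  by apply: poly_add (poly_mul poly_id _) _; apply: poly_const.
exists (machine_of p), c, k => x y; set N := size x + size y.
pose s1 := upd (fun i => nth [::] [:: x; y] i) 3 (nseq (V x y) true).
have D1 : does (compile K e (fun _ => 2) 3) (fun i => nth [::] [:: x; y] i) (time e N) s1.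
  rewrite /s1 -(He x y (fun _ => 0)); apply: compile_ok (ready_start x y) _ _ _ _ => //.
  - exact: leq_addr.
  - exact: leq_addl.
have D2 : does (clear K 0) s1 (N * 2).+1 (upd s1 0 [::]).
  by apply: does_clear => //; apply: leq_addr.
have D3 : does (casep 3 (push K 0 false) (skip K) (push K 0 true)) (upd s1 0 [::]) 3
    (upd (upd s1 0 [::]) 0 [:: V x y]).
  apply: does_case; first by rewrite /K addnC leq_addl.
  by rewrite {1}/upd {1}/s1 {1}/upd /=; case: (V x y); apply: does_push.
have := does_leq (n := c * N ^ k + c) _ (does_seq D1 (does_seq D2 D3)).
move/(_ _)/does_outputs; apply; apply: leq_trans (HT N).
by rewrite /T !addn1.
Qed.

Lemma definable_polytime_function (len : word -> nat) (b : word -> nat -> bool) :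
  definable (fun x y v => len x) -> definable (fun x y v => b x (v 0)) ->
  polytime_function (fun x => mkseq (b x) (len x)).
Proof.
case=> el Hl [eb Hb]; pose K := 6 + stacks el + stacks eb.
(* Tape 3 counts the letters still to be produced, tape 4 is the position passed to [b] as variable
   0, tape 6 receives the letter and tape 5 collects the output in reverse; the final [pour]
   reverses it back. *)
pose body := seqp (pop K 3) (seqp (compile K eb (push_env 4 (fun _ => 2)) 6)
  (seqp (casep 6 (push K 5 false) (skip K) (push K 5 true))
  (seqp (clear K 6) (push K 4 true)))).
pose p := seqp (compile K el (fun _ => 2) 3) (seqp (whilep 3 body)
  (seqp (clear K 0) (pour K 5 0))).
pose cb N := time eb (N + vbound el N) + 10.
pose T N := time el N + ((vbound el N * cb N + 1) + ((N * 2 + 1) + (vbound el N * 5 + 1))).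
have [c [k HT]] : exists c k, forall n, T n <= c * n ^ k + c.
  apply: poly_bounded_standard; have Pl := poly_vbound el.
  have cst q : poly_bounded (fun _ => q) by exact: poly_const.
  apply: poly_add (poly_time el) _; rewrite /cb.
  do !first [exact: Pl|exact: poly_id|exact: cst|exact: poly_time|apply: poly_add
    |apply: poly_mul|apply: (poly_comp (f := time eb))].
exists (machine_of p), c, k => x; set N := size x.
set n := len x.
have le_n : n <= vbound el N by rewrite /n -(Hl x [::] (fun _ => 0)); apply: eval_leq.
pose st i j o r := upd (upd (upd (upd (fun i => nth [::] [:: x] i) 3 (nseq i true)) 4 (nseq j true))
  5 o) 6 (nseq r true).
have sE : nth [::] [:: x] =1 nth [::] [:: x; [::]] by case=> [|[|[|i]]].
have R j i o : ready x [::] (push_env j (fun _ => 0)) (push_env 4 (fun _ => 2)) 6 (st i j o 0).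
  split=> // [[|l]|l le_l]; rewrite //= /st.
  by store_cases; rewrite nth_default //=; lia.
have D1 : does (compile K el (fun _ => 2) 3) (fun i => nth [::] [:: x] i) (time el N) (st n 0 [::] 0).
  apply: (does_ext _ _ (compile_ok (ready_start x [::]) (N := N) _ _ _ _)) => //.
  - move=> k'; rewrite Hl -/n /st; store_cases; by rewrite /= ?nth_nil.
  - rewrite /K; lia.
have Dbody j : j < n -> does body (st (n - j) j (rev (mkseq (b x) j)) 0) (cb N).-1
    (st (n - j.+1) j.+1 (rev (mkseq (b x) j.+1)) 0).
  move=> lt_j; set o := rev _; set n1 := n - j.+1.
  have E1 : does (pop K 3) (st (n - j) j o 0) 1 (st n1 j o 0).
    apply: (does_ext _ _ (does_pop K 3 _)) => [//|k']; rewrite /st.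
    by store_cases; rewrite -subnSK.
  have E2 : does (compile K eb (push_env 4 (fun _ => 2)) 6) (st n1 j o 0)
      (time eb (N + vbound el N)) (st n1 j o (b x j)).
    apply: (does_ext _ _ (compile_ok (R j n1 o) (N := N + vbound el N) _ _ _ _)) => //.
    - by move=> k'; rewrite Hb /st; store_cases.
    - rewrite /K; lia.
    - exact: leq_addr.
    - by case=> [|k'] /=; lia.
  have E3 : does (casep 6 (push K 5 false) (skip K) (push K 5 true)) (st n1 j o (b x j)) 3
      (st n1 j (rev (mkseq (b x) j.+1)) (b x j)).
    apply: does_case; first by rewrite /K; lia.
    rewrite {1}/st {1}/upd /= mkseqS rev_rcons -/o.
    case: (b x j) => /=; apply: (does_ext _ _ (does_push K 5 _ _)) => // k';
      by rewrite /st; store_cases.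
  have E4 : does (clear K 6) (st n1 j (rev (mkseq (b x) j.+1)) (b x j)) 3
      (st n1 j (rev (mkseq (b x) j.+1)) 0).
    apply: (does_ext _ _ (does_clear (n := 1) _ _)) => //.
    - by move=> k'; rewrite /st; store_cases.
    - by rewrite /st /upd /= size_nseq; case: (b x j).
  have E5 : does (push K 4 true) (st n1 j (rev (mkseq (b x) j.+1)) 0) 2
      (st n1 j.+1 (rev (mkseq (b x) j.+1)) 0).
    apply: (does_ext _ _ (does_push K 4 true _)) => // k'.
    by rewrite /st; store_cases.
  apply: does_leq _ (does_seq E1 (does_seq E2 (does_seq E3 (does_seq E4 E5)))).
  by rewrite /cb; lia.
have Dloop : does (whilep 3 body) (st n 0 [::] 0) (vbound el N * cb N + 1)
    (st 0 n (rev (mkseq (b x) n)) 0).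
  have cb1 : (cb N).-1.+1 = cb N by rewrite /cb addnS.
  apply: (@does_leq _ _ _ (n * (cb N).-1.+1).+1); first by rewrite addn1 ltnS cb1 leq_mul2r le_n orbT.
  have := does_while (K := K) (i := 3) (p := body) (N := n) (n := (cb N).-1)
      (st := fun i => st (n - i) i (rev (mkseq (b x) i)) 0).
  rewrite subn0 subnn; apply=> //.
  by move=> j lt_j; rewrite -size_eq0 /st /upd /= size_nseq; lia.
have D3 : does (clear K 0) (st 0 n (rev (mkseq (b x) n)) 0) (N * 2 + 1)
    (upd (st 0 n (rev (mkseq (b x) n)) 0) 0 [::]).
  by rewrite addn1; apply: (does_clear (n := N)); rewrite // /st /upd /=.
set S := upd _ 0 [::] in D3.
have D4 : does (pour K 5 0) S (vbound el N * 5 + 1) (upd (upd S 5 [::]) 0 (mkseq (b x) n)).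
  have Spop : S 5 = rev (mkseq (b x) n) by [].
  apply: (does_ext _ _ (does_leq _ (does_pour (s := S) (n := vbound el N) _ _ _))) => //.
  - by move=> i; rewrite Spop catrevE revK cats0.
  - by rewrite addn1.
  - by rewrite Spop size_rev size_mkseq.
by have := does_outputs (does_leq (HT N) (does_seq D1 (does_seq Dloop (does_seq D3 D4)))).
Qed.

(** * Definable functions *)

Fixpoint rename (r : env) (e : expr) : expr :=
  match e with
  | Var i => Var (r i)
  | One => One
  | Add e1 e2 => Add (rename r e1) (rename r e2)
  | Sub e1 e2 => Sub (rename r e1) (rename r e2)
  | Loop e1 e2 e3 =>
      let r1 := push_env 0 (succn \o r) in
      Loop (rename r e1) (rename r1 e2) (rename (push_env 0 (succn \o r1)) e3)
  | Bit b e => Bit b (rename r e)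
  | Len b => Len b
  end.

Lemma eval_rename x y e r v v' : (forall i, v' i = v (r i)) ->
  eval x y (rename r e) v = eval x y e v'.
Proof.
have push a r' w w' : (forall i, w' i = w (r' i)) ->
    forall i, push_env a w' i = push_env a w (push_env 0 (succn \o r') i).
  by move=> H [|i] //=.
elim: e r v v' => [i||e1 IH1 e2 IH2|e1 IH1 e2 IH2|e1 IH1 e2 IH2 e3 IH3|b e IH|b] //= r v v' H.
- by rewrite (IH1 _ v v') // (IH2 _ v v').
- by rewrite (IH1 _ v v') // (IH2 _ v v').
- rewrite (IH1 _ v v') //; apply: eq_loop => [i|i a]; first exact/IH2/push.
  by apply/IH3/push/push.
- by rewrite (IH _ v v').
Qed.

Lemma sum_count n (P : pred nat) : \sum_(0 <= i < n) P i = count P (iota 0 n).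
Proof. by rewrite /index_iota subn0 -sum1_count [RHS]big_mkcond. Qed.

Section Closure.

Implicit Types f g : word -> word -> env -> nat.
Implicit Types P Q : word -> word -> env -> bool.

Lemma def_ext f g : (forall x y v, g x y v = f x y v) -> definable f -> definable g.
Proof. by move=> E [e He]; exists e => x y v; rewrite He. Qed.

Lemma def_var i : definable (fun _ _ v => v i).
Proof. by exists (Var i). Qed.

Lemma def_add f g : definable f -> definable g -> definable (fun x y v => f x y v + g x y v).
Proof. by case=> e1 H1 [e2 H2]; exists (Add e1 e2) => x y v /=; rewrite H1 H2. Qed.

Lemma def_sub f g : definable f -> definable g -> definable (fun x y v => f x y v - g x y v).
Proof. by case=> e1 H1 [e2 H2]; exists (Sub e1 e2) => x y v /=; rewrite H1 H2. Qed.

Lemma def_const c : definable (fun _ _ _ => c).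
Proof.
elim: c => [|c [e He]]; first by exists (Sub One One).
by exists (Add One e) => x y v /=; rewrite He.
Qed.

Lemma def_succ f : definable f -> definable (fun x y v => (f x y v).+1).
Proof.
by move=> Hf; apply: (def_ext (fun _ _ _ => esym (addn1 _))); apply: def_add (def_const 1).
Qed.

Lemma def_pred f : definable f -> definable (fun x y v => (f x y v).-1).
Proof.
by move=> Hf; apply: (def_ext (fun _ _ _ => esym (subn1 _))); apply: def_sub (def_const 1).
Qed.

Lemma def_loop f (p : word -> word -> env -> nat -> nat) (m : word -> word -> env -> nat -> nat -> nat) :
  definable f -> definable (fun x y v => p x y (fun i => v i.+1) (v 0)) ->
  definable (fun x y v => m x y (fun i => v i.+2) (v 1) (v 0)) ->
  definable (fun x y v => loop (f x y v) (fun i => p x y v i) (fun i a => m x y v i a)).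
Proof.
case=> e1 H1 [e2 H2] [e3 H3]; exists (Loop e1 e2 e3) => x y v /=.
by rewrite H1; apply: eq_loop => [i|i a]; rewrite ?H2 ?H3.
Qed.

Lemma def_size_fst : definable (fun x _ _ => size x).
Proof. by exists (Len false). Qed.

Lemma def_size_snd : definable (fun _ y _ => size y).
Proof. by exists (Len true). Qed.

Lemma def_nth_fst f : definable f -> definable (fun x y v => nth false x (f x y v)).
Proof. by case=> e He; exists (Bit false e) => x y v /=; rewrite He. Qed.

Lemma def_nth_snd f : definable f -> definable (fun x y v => nth false y (f x y v)).
Proof. by case=> e He; exists (Bit true e) => x y v /=; rewrite He. Qed.

Lemma def_rename r f : definable f -> definable (fun x y v => f x y (fun i => v (r i))).
Proof.
case=> e He; exists (rename r e) => x y v.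
by rewrite (@eval_rename _ _ _ _ _ (fun i => v (r i))).
Qed.

Lemma def_weaken f : definable f -> definable (fun x y v => f x y (fun i => v i.+1)).
Proof. exact: (def_rename succn). Qed.

Lemma def_sum f (p : word -> word -> env -> nat -> nat) :
  definable f -> definable (fun x y v => p x y (fun i => v i.+1) (v 0)) ->
  definable (fun x y v => \sum_(0 <= i < f x y v) p x y v i).
Proof.
move=> Hf Hp; apply: def_ext (def_loop (p := p) (m := fun _ _ _ _ _ => 0) Hf Hp (def_const 0)) => x y v.
elim: (f x y v) => [|n IHn] /=; first by rewrite big_geq.
by rewrite big_nat_recr //= IHn ?subn0.
Qed.

Lemma def_mul f g : definable f -> definable g -> definable (fun x y v => f x y v * g x y v).
Proof.
move=> Hf Hg; apply: def_ext (def_sum (p := fun x y v _ => g x y v) Hf (def_weaken Hg)) => x y v.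
by rewrite sum_nat_const_nat subn0.
Qed.

Lemma def_exp f k : definable f -> definable (fun x y v => f x y v ^ k).
Proof.
move=> Hf; elim: k => [|k IHk]; first exact: def_const.
by apply: def_ext (def_mul Hf IHk) => x y v; rewrite expnS.
Qed.

Lemma def_leq f g : definable f -> definable g -> definable (fun x y v => f x y v <= g x y v).
Proof.
move=> Hf Hg; apply: def_ext (def_sub (def_const 1) (def_sub Hf Hg)) => x y v.
by rewrite /leq; case: (_ - _).
Qed.

Lemma def_and P Q : definable P -> definable Q -> definable (fun x y v => P x y v && Q x y v).
Proof. by move=> HP HQ; apply: def_ext (def_mul HP HQ) => x y v; rewrite mulnb. Qed.

Lemma def_neg P : definable P -> definable (fun x y v => ~~ P x y v).
Proof.
by move=> HP; apply: def_ext (def_sub (def_const 1) HP) => x y v; case: (P x y v).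
Qed.

Lemma def_or P Q : definable P -> definable Q -> definable (fun x y v => P x y v || Q x y v).
Proof.
move=> HP HQ; apply: def_ext (def_neg (def_and (def_neg HP) (def_neg HQ))) => x y v.
by rewrite negb_and !negbK.
Qed.

Lemma def_imply P Q : definable P -> definable Q -> definable (fun x y v => P x y v ==> Q x y v).
Proof. by move=> HP HQ; apply: def_ext (def_or (def_neg HP) HQ) => x y v; rewrite implybE. Qed.

Lemma def_eq f g : definable f -> definable g -> definable (fun x y v => f x y v == g x y v).
Proof.
by move=> Hf Hg; apply: def_ext (def_and (def_leq Hf Hg) (def_leq Hg Hf)) => x y v; rewrite eqn_leq.
Qed.

Lemma def_eqb P Q : definable P -> definable Q -> definable (fun x y v => P x y v == Q x y v).
Proof.
by move=> Hf Hg; apply: def_ext (def_eq Hf Hg) => x y v; case: (P x y v); case: (Q x y v).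
Qed.

Lemma def_if P f g : definable P -> definable f -> definable g ->
  definable (fun x y v => if P x y v then f x y v else g x y v).
Proof.
move=> HP Hf Hg; apply: def_ext (def_add (def_mul HP Hf) (def_mul (def_neg HP) Hg)) => x y v.
by case: (P x y v); rewrite !(mul1n, mul0n, addn0).
Qed.

Lemma def_ifb P Q Q' : definable P -> definable Q -> definable Q' ->
  definable (fun x y v => nat_of_bool (if P x y v then Q x y v else Q' x y v)).
Proof. by move=> HP HQ HQ'; apply: def_ext (def_if HP HQ HQ') => x y v; case: (P x y v). Qed.

Lemma def_has f (P : word -> word -> env -> nat -> bool) :
  definable f -> definable (fun x y v => P x y (fun i => v i.+1) (v 0)) ->
  definable (fun x y v => has (fun i => P x y v i) (iota 0 (f x y v))).
Proof.
move=> Hf HP; apply: def_ext (def_leq (def_const 1) (def_sum (p := fun x y v i => P x y v i) Hf HP)) => x y v; congr nat_of_bool.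
by rewrite sum_count has_count.
Qed.

Lemma def_all f (P : word -> word -> env -> nat -> bool) :
  definable f -> definable (fun x y v => P x y (fun i => v i.+1) (v 0)) ->
  definable (fun x y v => all (fun i => P x y v i) (iota 0 (f x y v))).
Proof.
move=> Hf HP.
apply: def_ext (def_neg (def_has (P := fun x y v i => ~~ P x y v i) Hf (def_neg HP))) => x y v.
by rewrite has_predC negbK.
Qed.

Lemma sum_ltn n k : k <= n -> \sum_(0 <= i < n) (i < k) = k.
Proof.
move=> le_kn; rewrite (sum_count n (fun i => i < k)) -(subnKC le_kn) iotaD count_cat add0n.
rewrite (eq_in_count (a2 := xpredT)); last by move=> i; rewrite mem_iota.
rewrite (eq_in_count (a2 := xpred0) (s := iota k _)); last by move=> i; rewrite mem_iota; lia.
by rewrite count_predT count_pred0 size_iota addn0.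
Qed.

Lemma def_div f g : definable f -> definable g -> definable (fun x y v => f x y v %/ g x y v).
Proof.
(* The quotient counts the positive multiples of the divisor up to the dividend; the second conjunct
   gives 0 for a zero divisor, in accordance with [divn0]. *)
move=> Hf Hg; pose p x y v i := (i.+1 * g x y v <= f x y v) && (0 < g x y v).
have Hp : definable (fun x y v => p x y (fun i => v i.+1) (v 0)).
  have [Hf' Hg'] := (def_weaken Hf, def_weaken Hg).
  by apply: def_and (def_leq (def_mul (def_succ (def_var 0)) Hg') Hf') (def_leq (def_const 1) Hg').
apply: def_ext (def_sum (p := fun x y v i => p x y v i) Hf Hp) => x y v.
case: (posnP (g x y v)) => [g0|g_gt0].
  by rewrite g0 divn0 big1 // => i _; rewrite /p g0 andbF.
rewrite -[LHS](sum_ltn (n := f x y v)) ?leq_div //.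
by apply: eq_bigr => i _; rewrite /p g_gt0 andbT leq_divRL.
Qed.

Lemma def_mod f g : definable f -> definable g -> definable (fun x y v => f x y v %% g x y v).
Proof.
move=> Hf Hg; apply: def_ext (def_sub Hf (def_mul (def_div Hf Hg) Hg)) => x y v.
by rewrite {2}(divn_eq (f x y v) (g x y v)) addKn.
Qed.

Lemma def_half f : definable f -> definable (fun x y v => (f x y v)./2).
Proof. by move=> Hf; apply: def_ext (def_div Hf (def_const 2)) => x y v; rewrite divn2. Qed.

Lemma def_double f : definable f -> definable (fun x y v => (f x y v).*2).
Proof. by move=> Hf; apply: def_ext (def_mul Hf (def_const 2)) => x y v; rewrite muln2. Qed.

Lemma def_odd f : definable f -> definable (fun x y v => odd (f x y v)).
Proof. by move=> Hf; apply: def_ext (def_mod Hf (def_const 2)) => x y v; rewrite modn2. Qed.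

Lemma def_min f g : definable f -> definable g -> definable (fun x y v => minn (f x y v) (g x y v)).
Proof.
by move=> Hf Hg; apply: def_ext (def_sub Hf (def_sub Hf Hg)) => x y v; rewrite minnE.
Qed.

(** A finite table is wired into the expression as nested conditionals; the transition function of a
    machine enters the reduction in this way. *)
Lemma def_table m (t : nat -> nat) f : definable f ->
  definable (fun x y v => if f x y v < m then t (f x y v) else 0).
Proof.
move=> Hf; elim: m => [|m IHm]; first by apply: def_ext (def_const 0).
apply: def_ext (def_if (def_eq Hf (def_const m)) (def_const (t m)) IHm) => x y v.
by rewrite ltnS leq_eqVlt; case: eqP => [->|]; rewrite ?eqxx.
Qed.

(** A local definition becomes a sum over [i <= f x y v] in which the factor [i == f x y v] leaves a
    single term. *)
Lemma def_subst (F : word -> word -> env -> nat -> nat) f :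
  definable f -> definable (fun x y v => F x y (fun i => v i.+1) (v 0)) ->
  definable (fun x y v => F x y v (f x y v)).
Proof.
move=> Hf HF.
have H := def_mul (def_eq (def_var 0) (def_weaken Hf)) HF.
apply: def_ext (def_sum (p := fun x y v i => (i == f x y v) * F x y v i) (def_succ Hf) H) => x y v.
rewrite big_nat_recr //= eqxx mul1n big_nat big1 // => i /andP[_ lt_i].
by rewrite ltn_eqF.
Qed.

(* Primitive recursion, for values that stay below a definable bound [b]: the
   loop adds [b] before each step, so that the new value is reached by a
   subtraction. *)
Lemma def_iteri n b (a : word -> word -> env -> nat)
    (F : word -> word -> env -> nat -> nat -> nat) :
  definable n -> definable b -> definable a ->
  definable (fun x y v => F x y (fun i => v i.+2) (v 1) (v 0)) ->
  (forall x y v, a x y v <= b x y v) ->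
  (forall x y v i u, u <= b x y v -> F x y v i u <= b x y v) ->
  definable (fun x y v => iteri (n x y v) (F x y v) (a x y v)).
Proof.
move=> Hn Hb Ha HF le_ab le_Fb.
(* Subtracting [u - t] from [u] leaves the target [t], because [t <= b <= u]. Round 0 installs the
   initial value, so the loop takes one round more than the recursion, and [u - b] is the previous
   value. *)
pose m x y v i u := u - (if i == 0 then a x y v else minn (b x y v) (F x y v i.-1 (u - b x y v))).
have Hm : definable (fun x y v => m x y (fun i => v i.+2) (v 1) (v 0)).
  have [{}Ha Hb2] := (def_weaken (def_weaken Ha), def_weaken (def_weaken Hb)).
  apply: def_sub (def_var 0) (def_if (def_eq (def_var 1) (def_const 0)) Ha (def_min Hb2 _)).
  apply: (def_subst (F := fun x y v u => F x y (fun i => v i.+2) (v 1).-1 u)).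
    exact: def_sub (def_var 0) Hb2.
  apply: (def_subst (F := fun x y v j => F x y (fun i => v i.+3) j (v 0))).
    exact: def_pred (def_var 2).
  (* After both substitutions variable 0 is the predecessor of the loop index, variable 1 is the
     previous value and the parameters start at 4. *)
  exact: def_ext (def_rename (fun i => if i is j.+2 then j.+4 else if i is 1 then 0 else 1) HF).
apply: def_ext (def_loop (p := fun x y v _ => b x y v) (m := m) (def_succ Hn) (def_weaken Hb) Hm) => x y v.
suff H k : loop k.+1 (fun=> b x y v) (m x y v) = iteri k (F x y v) (a x y v) by exact/esym.
have le_iter : iteri k (F x y v) (a x y v) <= b x y v.
  by elim: k => [|k IHk] /=; [apply: le_ab|apply: le_Fb].
elim: k le_iter => [|k IHk] le_iter; first by have := le_ab x y v; rewrite /= /m /=; lia.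
have le_k : iteri k (F x y v) (a x y v) <= b x y v.
  by elim: k {le_iter IHk} => [|k IHk] /=; [apply: le_ab|apply: le_Fb].
rewrite -[LHS]/(let u := loop k.+1 _ _ + _ in u - m x y v k.+1 u) IHk //=.
rewrite /m /= addnK; move: le_iter => /=. lia.
Qed.

End Closure.

Ltac definable_leaf := idtac; fail.

Ltac definable_step :=
  lazymatch goal with
  | |- definable (fun x y v => nat_of_bool (@?P x y v && @?Q x y v)) => apply (@def_and P Q)
  | |- definable (fun x y v => nat_of_bool (@?P x y v || @?Q x y v)) => apply (@def_or P Q)
  | |- definable (fun x y v => nat_of_bool (@?P x y v ==> @?Q x y v)) => apply (@def_imply P Q)
  | |- definable (fun x y v => nat_of_bool (~~ @?P x y v)) => apply (@def_neg P)
  | |- definable (fun x y v => nat_of_bool (@?f x y v <= @?g x y v)) => apply (@def_leq f g)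
  | |- definable (fun x y v => nat_of_bool (@?f x y v == @?g x y v)) =>
      first [apply (@def_eq f g) | apply (@def_eqb f g)]
  | |- definable (fun x y v => nat_of_bool (odd (@?f x y v))) => apply (@def_odd f)
  | |- definable (fun x y v => nat_of_bool (all (@?P x y v) (iota 0 (@?f x y v)))) =>
      apply (@def_all f P)
  | |- definable (fun x y v => nat_of_bool (has (@?P x y v) (iota 0 (@?f x y v)))) =>
      apply (@def_has f P)
  | |- definable (fun x y v => bigop _ (index_iota 0 (@?f x y v)) _) => apply (@def_sum f)
  | |- definable (fun x y v => @?f x y v + @?g x y v) => apply (@def_add f g)
  | |- definable (fun x y v => @?f x y v - @?g x y v) => apply (@def_sub f g)
  | |- definable (fun x y v => @?f x y v * @?g x y v) => apply (@def_mul f g)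
  | |- definable (fun x y v => @?f x y v %/ @?g x y v) => apply (@def_div f g)
  | |- definable (fun x y v => @?f x y v %% @?g x y v) => apply (@def_mod f g)
  | |- definable (fun x y v => minn (@?f x y v) (@?g x y v)) => apply (@def_min f g)
  | |- definable (fun x y v => (@?f x y v)./2) => apply (@def_half f)
  | |- definable (fun x y v => (@?f x y v).*2) => apply (@def_double f)
  | |- definable (fun x y v => (@?f x y v).-1) => apply (@def_pred f)
  | |- definable (fun x y v => @?f x y v ^ ?k) => apply (@def_exp f k)
  | |- definable (fun x y v => v _) => apply def_var
  | |- definable (fun x y v => (@?f x y v).+1) => apply (@def_succ f)
  | |- definable (fun x y v => size x) => apply def_size_fst
  | |- definable (fun x y v => size y) => apply def_size_snd
  | |- definable (fun x y v => nat_of_bool (nth false x (@?f x y v))) => apply (@def_nth_fst f)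
  | |- definable (fun x y v => nat_of_bool (nth false y (@?f x y v))) => apply (@def_nth_snd f)
  | |- _ => first [apply def_const | apply def_ifb | apply def_if]
  end; cbv beta.

Ltac definable := repeat first [definable_leaf; cbv beta | assumption | definable_step].

(** * Encodings of graphs *)

Definition agrees (G : graph) (m : nat -> nat -> bool) :=
  forall i j : 'I_(order G), m i j = adj i j.

Definition encode_nat n (m : nat -> nat -> bool) (rb : word) : word :=
  nseq n true ++ false :: mkseq (fun q => m (q %/ n) (q %% n)) (n * n) ++ rb.

Lemma allpairs_iota (T : Type) (f : nat -> nat -> T) a n :
  [seq f i j | i <- iota 0 a, j <- iota 0 n] = mkseq (fun q => f (q %/ n) (q %% n)) (a * n).
Proof.
elim: a => [//|a IHa].
rewrite -addn1 iotaD map_cat flatten_cat IHa /= cats0 mulnDl mul1n /mkseq iotaD map_cat.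
congr cat; rewrite add0n -[in RHS](addn0 (a * n)) (iotaDl (a * n)) -map_comp; apply/eq_in_map => j.
rewrite mem_iota => /= lt_jn; have n_gt0 : 0 < n by lia.
by rewrite divnMDl // modnMDl divn_small // modn_small // addn0.
Qed.

Lemma encodeE G r m : agrees G m -> encode G r = encode_nat (order G) m (bits r).
Proof.
move=> Em; congr (_ ++ _ :: _ ++ _); rewrite -(allpairs_iota m) -val_enum_ord.
rewrite allpairs_mapl allpairs_mapr.
by apply: eq_allpairs => i j /=; rewrite Em.
Qed.

(** The length of the leading block of ones, written as the number of prefixes without a zero so as
    to be a definable sum. *)
Definition graph_size (w : word) :=
  \sum_(0 <= i < size w) all (fun j => nth false w j) (iota 0 i.+1).

Definition matrix_entry (w : word) i j := nth false w (graph_size w + 1 + (i * graph_size w + j)).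

Definition radius_pos w := graph_size w + 1 + graph_size w * graph_size w.

Definition radius_bits w := drop (radius_pos w) w.

Lemma graph_sizeE w : graph_size w = index false w.
Proof.
rewrite -[RHS](sum_ltn (index_size false w)) /graph_size; apply: eq_big_nat => i /andP[_ lt_i].
congr nat_of_bool; apply/allP/idP => [H|lt_index j].
  rewrite ltnNge; apply/negP => le_index.
  have /H : index false w \in iota 0 i.+1 by rewrite mem_iota.
  by rewrite nth_index // -index_mem (leq_ltn_trans le_index).
rewrite mem_iota => lt_j; have := before_find false (leq_trans lt_j lt_index).
by move=> /= /negbT; rewrite eqbF_neg negbK.
Qed.

Lemma graph_size_leq w : graph_size w <= size w.
Proof. by rewrite graph_sizeE index_size. Qed.

Section Decode.

Variables (n : nat) (m : nat -> nat -> bool) (rb : word).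

Local Notation w := (encode_nat n m rb).

Lemma graph_size_encode : graph_size w = n.
Proof.
rewrite graph_sizeE index_cat size_nseq /= addn0.
by case: ifP => // /nseqP[].
Qed.

Lemma radius_pos_encode : radius_pos w = n + 1 + n * n.
Proof. by rewrite /radius_pos graph_size_encode. Qed.

Lemma size_encode : size w = n + 1 + n * n + size rb.
Proof. by rewrite size_cat size_nseq /= size_cat size_mkseq; lia. Qed.

Lemma matrix_entry_encode i j : i < n -> j < n -> matrix_entry w i j = m i j.
Proof.
move=> lt_i lt_j; rewrite /matrix_entry graph_size_encode nth_cat size_nseq ifF; last lia.
rewrite (_ : _ - n = (i * n + j).+1); last lia.
have lt_ij : i * n + j < n * n by nia.
rewrite /= nth_cat size_mkseq lt_ij nth_mkseq //.
by rewrite divnMDl ?modnMDl ?divn_small ?modn_small ?addn0 //; lia.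
Qed.

Lemma radius_bits_encode : radius_bits w = rb.
Proof.
rewrite /radius_bits radius_pos_encode drop_cat size_nseq ifF; last lia.
rewrite (_ : _ - n = (n * n).+1) ?drop_cons ?drop_cat ?size_mkseq ?ltnn ?subnn ?drop0 //; last lia.
Qed.

End Decode.

(** Since decoding applies to every long enough word, the verifier recognises encodings by tests on
    the length, the matrix and the last letter alone. *)
Lemma decodeK w : radius_pos w <= size w ->
  w = encode_nat (graph_size w) (matrix_entry w) (radius_bits w).
Proof.
move=> le_w; apply: (@eq_from_nth _ false) => [|k lt_k].
  by rewrite size_encode size_drop; rewrite /radius_pos in le_w *; lia.
rewrite nth_cat size_nseq; set n := graph_size w.
case: ltnP => [lt_kn|le_nk].
  rewrite nth_nseq lt_kn; move: lt_kn; rewrite /n graph_sizeE => /(before_find false) /= /negbT.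
  by rewrite eqbF_neg negbK.
case Ek: (k - n) => [|k'] /=.
  have -> : k = n by lia.
  rewrite /n graph_sizeE nth_index // -index_mem.
  by apply: leq_trans _ le_w; rewrite -graph_sizeE /radius_pos addn1 leq_addr.
rewrite nth_cat size_mkseq; case: ltnP => [lt_k'|le_k'].
  rewrite nth_mkseq // /matrix_entry -/n -divn_eq; congr nth; lia.
rewrite /radius_bits nth_drop /radius_pos -/n; congr nth; lia.
Qed.

(** * Binary notation and the radius *)

Fixpoint value (w : word) : nat := if w is b :: w' then b + (value w').*2 else 0.

Lemma value_pos_bits p : value (pos_bits p) = nat_of_bin (BinNums.Npos p).
Proof. by elim: p => [p /= ->|p /= ->|//]; rewrite NatTrec.doubleE ?add0n ?add1n. Qed.

Lemma value_bits r : value (bits r) = r.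
Proof. by rewrite /bits -[RHS]bin_of_natK; case: (bin_of_nat r) => // p; apply: value_pos_bits. Qed.

Lemma last_pos_bits p b : last b (pos_bits p).
Proof. by elim: p b => /=. Qed.

Lemma last_bits r : 0 < r -> last false (bits r).
Proof.
rewrite /bits -{1}(bin_of_natK r); case: (bin_of_nat r) => // p _.
exact: last_pos_bits.
Qed.

Lemma value_gt0 w : last false w -> 0 < value w.
Proof.
elim: w => [|b w IHw] //=; case: w IHw => [|c w] /= IHw H; first by rewrite H.
by rewrite addn_gt0 double_gt0 IHw ?orbT.
Qed.

(** A final 1 characterises the notations of positive numbers without padding; so one test on the
    last letter excludes both a zero radius and a non-canonical word. *)
Lemma bits_value w : last false w -> bits (value w) = w.
Proof.
have posP : last false w -> exists p, w = pos_bits p.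
  elim: w => [//|b w IHw] /=; case: w IHw => [|c w] IHw H.
    by case: b H => // _; exists BinNums.xH.
  case: IHw => // p ->.
  by case: b {H}; [exists (BinNums.xI p)|exists (BinNums.xO p)].
by case/posP => p ->; rewrite /bits value_pos_bits nat_of_binK.
Qed.

(** Horner's rule from the most significant bit, cut off at the order in each step so that the unary
    value stays small; no loss, as an alliance has no more vertices than the graph. *)
Definition clipped_radius w :=
  iteri (size w - radius_pos w)
    (fun i u => minn (graph_size w) (u * 2 + nth false w (size w - i.+1))) 0.

Lemma clipped_radiusE w : clipped_radius w = minn (graph_size w) (value (radius_bits w)).
Proof.
have drop_value s k : k < size s -> value (drop k s) = nth false s k + (value (drop k.+1 s)).*2.
  by move=> lt_k; rewrite (drop_nth false).
rewrite /clipped_radius; set L := size w - _; have sL : size (radius_bits w) = L by rewrite size_drop.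
suff H k : k <= L -> iteri k (fun i u => minn (graph_size w) (u * 2 + nth false w (size w - i.+1))) 0 =
    minn (graph_size w) (value (drop (L - k) (radius_bits w))).
  by rewrite H // subnn drop0.
elim: k => [_|k IHk lt_k]; first by rewrite subn0 -sL drop_size minn0.
rewrite iteriS IHk ?(ltnW lt_k) // (drop_value _ (L - k.+1)); last by rewrite sL; lia.
have -> : (L - k.+1).+1 = L - k by lia.
have -> : nth false (radius_bits w) (L - k.+1) = nth false w (size w - k.+1).
  by rewrite nth_drop; congr nth; move: lt_k; rewrite /L; lia.
(* Clipping early is harmless: [minn n (minn n u * 2 + b) = minn n (u * 2 + b)]. *)
by move: (value _) => u; lia.
Qed.

(** * Alliances in arithmetic form and the verifier *)

Definition degree_nat n (m : nat -> nat -> bool) (P : nat -> bool) v :=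
  \sum_(0 <= u < n) (P u && m v u).

Definition alliance_nat n m (P : nat -> bool) :=
  has (fun u => P u) (iota 0 n) &&
  all (fun v => (~~ P v && has (fun u => P u && m u v) (iota 0 n)) ==>
    (degree_nat n m (fun u => ~~ P u) v + 1 <= degree_nat n m P v)) (iota 0 n).

Lemma has_iota_ord n (P : nat -> bool) : has P (iota 0 n) = [exists i : 'I_n, P i].
Proof.
apply/hasP/existsP => [[i]|[i Pi]]; last by exists (val i); rewrite // mem_iota /=.
by rewrite mem_iota => /= lt_i Pi; exists (Ordinal lt_i).
Qed.

Lemma all_iota_ord n (P : nat -> bool) : all P (iota 0 n) = [forall i : 'I_n, P i].
Proof. by rewrite -[LHS]negbK -has_predC has_iota_ord negb_exists; apply: eq_forallb => i /=; rewrite negbK. Qed.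

Lemma card_set_nat n (P : nat -> bool) : #|[set i : 'I_n | P i]| = \sum_(0 <= i < n) P i.
Proof. by rewrite -sum1_card big_mkord [LHS]big_mkcond; apply: eq_bigr => i _; rewrite inE. Qed.

Lemma alliance_natP G m (P : nat -> bool) : agrees G m ->
  reflect (offensive_alliance [set i : 'I_(order G) | P i]) (alliance_nat (order G) m P).
Proof.
move=> Em; set S := [set i : 'I_(order G) | P i]; rewrite /alliance_nat has_iota_ord all_iota_ord.
have degE (Q : nat -> bool) (v : 'I_(order G)) : degree_nat (order G) m Q v = degree_in [set i : 'I_(order G) | Q i] v.
  rewrite /degree_nat /degree_in -[RHS]sum1_card big_mkord [RHS]big_mkcond.
  by apply: eq_bigr => i _; rewrite !inE Em; case: (_ && _).
have -> : [exists i : 'I_(order G), P i] = (S != set0).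
  apply/existsP/set0Pn => -[i Pi]; exists i; first by rewrite inE.
  by rewrite inE in Pi.
have SC : ~: S = [set i : 'I_(order G) | ~~ P i] by apply/setP => i; rewrite !inE.
apply: (iffP andP) => -[S0 H]; split=> //.
  move=> v; rewrite inE => /andP[vS /existsP[u /andP[uS uv]]].
  move/forallP: H => /(_ v); rewrite inE in vS; rewrite vS has_iota_ord /=.
  rewrite !degE SC => /implyP; apply; apply/existsP; exists u.
  by rewrite Em uv andbT; rewrite inE in uS.
apply/forallP => v; apply/implyP => /andP[vS]; rewrite has_iota_ord => /existsP[u /andP[Pu uv]].
rewrite !degE -SC; apply: H; rewrite !inE vS; apply/existsP; exists u.
by rewrite inE Pu -Em.
Qed.

Definition mk_graph n (m : nat -> nat -> bool)
    (sym : forall i j : 'I_n, m i j = m j i) (irr : forall i : 'I_n, m i i = false) : graph :=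
  @Graph n (fun i j => m i j) sym irr.

Definition nat_adj (G : graph) i j :=
  if insub i is Some a then if insub j is Some b then @adj G a b else false else false.

Lemma nat_adj_agrees G : agrees G (@nat_adj G).
Proof. by move=> i j; rewrite /nat_adj !valK. Qed.

(** The first [n] letters of [y] mark the alliance; what follows is the certificate that [chk] uses
    for membership in the class. *)
Definition verifier (chk : nat -> (nat -> nat -> bool) -> word -> bool) (w y : word) :=
  let n := graph_size w in
  [&& radius_pos w < size w, nth false w (size w).-1,
      all (fun i => ~~ matrix_entry w i i &&
        all (fun j => matrix_entry w i j == matrix_entry w j i) (iota 0 n)) (iota 0 n),
      alliance_nat n (matrix_entry w) (fun i => nth false y i),
      \sum_(0 <= i < n) nth false y i <= clipped_radius w &
      chk n (matrix_entry w) (drop n y)].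

Lemma last_radius_bits w : radius_pos w < size w ->
  last false (radius_bits w) = nth false w (size w).-1.
Proof.
move=> lt_w; rewrite -nth_last nth_drop size_drop; congr nth; lia.
Qed.

Lemma verifierP (C : graph -> Prop) (chk : nat -> (nat -> nat -> bool) -> word -> bool) :
  (forall G m, agrees G m ->
    C G -> exists2 y : word, size y <= order G ^ 4 & chk (order G) m y) ->
  (forall G m y, agrees G m -> chk (order G) m y -> C G) ->
  forall w, OA_yes C w <-> exists y : word, size y <= 2 * size w ^ 4 + 2 /\ verifier chk w y.
Proof.
move=> chk_complete chk_sound w; split.
  case=> G [r [CG r_gt0 w_def [S [al /andP[S_gt0 S_le]]]]].
  have E := encodeE r (@nat_adj_agrees G); rewrite -w_def in E.
  set n := order G in E *.
  have nE : graph_size w = n by rewrite E graph_size_encode.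
  have mE : agrees G (matrix_entry w).
    by move=> i j; rewrite E matrix_entry_encode // nat_adj_agrees.
  have rE : radius_bits w = bits r by rewrite E radius_bits_encode.
  have [yc le_yc yc_ok] := chk_complete G _ mE CG.
  pose yS := [seq i \in S | i <- enum 'I_n].
  have size_yS : size yS = n by rewrite size_map size_enum_ord.
  have ySE (i : 'I_n) : nth false (yS ++ yc) i = (i \in S).
    by rewrite nth_cat size_yS ltn_ord (nth_map i) ?size_enum_ord // nth_ord_enum.
  have SE : S = [set i : 'I_n | nth false (yS ++ yc) i] by apply/setP => i; rewrite inE ySE.
  have lt_pos : radius_pos w < size w.
    rewrite E radius_pos_encode size_encode -addn1 leq_add2l.
    by case: (bits r) (last_bits r_gt0).
  (* The two parts have [n] and at most [n ^ 4] letters, and each of these numbers is at most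
     [size w ^ 4]. *)
  exists (yS ++ yc); split.
    rewrite size_cat size_yS; have le_nw : n <= size w by rewrite -nE graph_size_leq.
    have : n ^ 4 <= size w ^ 4 by rewrite leq_exp2r.
    have : size w <= size w ^ 4 by rewrite -{1}[size w]expn1; case: (size w) => // k; rewrite leq_pexp2l.
    by rewrite -/n in le_yc; lia.
  apply/and5P; split=> //.
  - by rewrite -last_radius_bits // rE last_bits.
  - rewrite nE all_iota_ord; apply/forallP => i; rewrite all_iota_ord mE adj_irr /=.
    by apply/forallP => j; rewrite !mE adj_sym.
  - by rewrite nE; apply/(alliance_natP _ mE); rewrite -SE.
  - apply/andP; split; last first.
      by rewrite nE -size_yS drop_size_cat // size_yS.
    rewrite clipped_radiusE rE value_bits nE -card_set_nat -SE leq_min S_le.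
    by rewrite -[X in _ <= X]card_ord max_card.
case=> y [_ /and5P[lt_pos last_w /allP sym_w al_y /andP[le_y chk_y]]].
have in_w (i : 'I_(graph_size w)) : val i \in iota 0 (graph_size w) by rewrite mem_iota /=.
have irr (i : 'I_(graph_size w)) : matrix_entry w i i = false.
  by have /andP[/negPf] := sym_w _ (in_w i).
have sym (i j : 'I_(graph_size w)) : matrix_entry w i j = matrix_entry w j i.
  have /andP[_ /allP H] := sym_w _ (in_w i).
  exact/eqP/(H _ (in_w j)).
pose G := mk_graph sym irr.
have GE : agrees G (matrix_entry w) by [].
have last_rb : last false (radius_bits w) by rewrite last_radius_bits.
exists G, (value (radius_bits w)); split.
- exact: (chk_sound G _ _ GE chk_y).
- exact: value_gt0.
- by rewrite (encodeE _ GE) bits_value // -decodeK // ltnW.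
- exists [set i : 'I_(order G) | nth false y i]; split; first exact/(alliance_natP _ GE).
  have [S0 _] : offensive_alliance [set i : 'I_(order G) | nth false y i].
    exact/(alliance_natP _ GE).
  rewrite card_gt0 S0 (card_set_nat (order G) (nth false y)).
  by apply: leq_trans le_y _; rewrite clipped_radiusE geq_minr.
Qed.

Lemma def_graph_size : definable (fun x _ _ => graph_size x).
Proof. by rewrite /graph_size; definable. Qed.

Lemma def_matrix_entry f g : definable f -> definable g ->
  definable (fun x y v => matrix_entry x (f x y v) (g x y v)).
Proof. by move=> Hf Hg; have H := def_graph_size; rewrite /matrix_entry; definable. Qed.

Lemma def_nth_drop f : definable f ->
  definable (fun x y v => nth false (drop (graph_size x) y) (f x y v)).
Proof.
move=> Hf; apply: def_ext (def_nth_snd (def_add def_graph_size Hf)) => x y v.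
by rewrite nth_drop.
Qed.

Lemma def_clipped_radius : definable (fun x _ _ => clipped_radius x).
Proof.
have H := def_graph_size; have H' : definable (fun x _ _ => radius_pos x).
  by rewrite /radius_pos; definable.
apply: (def_iteri (n := fun x _ _ => size x - radius_pos x) (b := fun x _ _ => graph_size x)
  (a := fun _ _ _ => 0)
  (F := fun x _ _ i u => minn (graph_size x) (u * 2 + nth false x (size x - i.+1)))) => //.
- by definable.
- by definable.
- by apply: def_min; definable.
- by move=> x _ _ i u _; rewrite geq_minl.
Qed.

Ltac definable_leaf ::=
  lazymatch goal with
  | |- definable (fun x y v => graph_size x) => apply def_graph_size
  | |- definable (fun x y v => clipped_radius x) => apply def_clipped_radius
  | |- definable (fun x y v => nat_of_bool (matrix_entry x (@?f x y v) (@?g x y v))) =>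
      apply (@def_matrix_entry f g)
  | |- definable (fun x y v => nat_of_bool (nth false (drop (graph_size x) y) (@?f x y v))) =>
      apply (@def_nth_drop f)
  end.

Lemma in_NP_Offensive_Alliance (C : graph -> Prop) (chk : nat -> (nat -> nat -> bool) -> word -> bool) :
  (forall G m, agrees G m ->
    C G -> exists2 y : word, size y <= order G ^ 4 & chk (order G) m y) ->
  (forall G m y, agrees G m -> chk (order G) m y -> C G) ->
  definable (fun x y _ => chk (graph_size x) (matrix_entry x) (drop (graph_size x) y)) ->
  in_NP (yes (Offensive_Alliance C)).
Proof.
move=> chk_complete chk_sound chk_def; exists (verifier chk), 2, 4; split; last exact: verifierP.
apply: definable_polytime_relation; rewrite /verifier /alliance_nat /degree_nat /radius_pos.
by definable.
Qed.

(** * Chordal and split graphs *)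

Section Chordal.

Variable G : graph.
Local Notation V := 'I_(order G).
Local Notation adj := (@adj G).
Implicit Types v a b w : V.

Definition avoiding v a b : rel V := fun u w =>
  adj u w && [|| w == a, w == b | (w != v) && ~~ adj v w].

(* A hole through [v] is an induced path between two non-adjacent neighbours of
   [v] which otherwise avoids the closed neighbourhood of [v]. *)
Definition hole_free := forall v a b,
  adj v a -> adj v b -> a != b -> ~~ adj a b -> ~~ connect (avoiding v a b) a b.

Lemma prev_head (T : eqType) (x : T) c : uniq (x :: c) -> prev (x :: c) x = last x c.
Proof.
rewrite cons_uniq => /andP[x_c _]; rewrite prev_nth mem_head.
have -> : index x c = size c.
  by apply/eqP; rewrite eqn_leq index_size leqNgt index_mem.
by rewrite -[size c]/(size (x :: c)).-1 nth_last.
Qed.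

(** In a chordless cycle through [v], the neighbours [a] and [b] of [v] on the cycle are not
    adjacent, and the remaining arc joins them without meeting another neighbour of [v]. *)
Lemma hole_free_chordal : hole_free -> chordal_graph G.
Proof.
move=> HF [|v [|a [|q [|r p']]]] // /andP[]; set p := q :: r :: p' => cyc Uc _.
have : path adj v (rcons (a :: p) v) by [].
rewrite rcons_path => /andP[/andP[va ap] bv] {cyc}.
set c := v :: a :: p in Uc *; set b := last a p in bv.
pose chord := [exists u, exists w,
  [&& u \in c, w \in c, adj u w, w != next c u & u != next c w]].
have [/existsP[u /existsP[w /and5P[? ? ? ? ?]]]|no_chord] := boolP chord.
  by exists u, w; split.
have {}no_chord u w : u \in c -> w \in c -> adj u w -> w != next c u -> u = next c w.
  move=> uc wc uw wu; apply/eqP; apply: contraNT no_chord => wu'.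
  by apply/existsP; exists u; apply/existsP; exists w; apply/and5P.
have next_v : next c v = a by rewrite /c /= eqxx.
have b_p : b \in p by exact: (mem_last q (r :: p')).
have v_ap : v \notin a :: p by case/andP: Uc.
have a_p : a \notin p by case/and3P: Uc.
have p_c w : w \in p -> w \in c by move=> wp; rewrite 2!in_cons wp !orbT.
have [b_c a_c v_c] : [/\ b \in c, a \in c & v \in c].
  by split; [apply: p_c|rewrite /c !in_cons eqxx orbT|apply: mem_head].
have a_v : a != v by apply: contraNneq v_ap => ->; rewrite mem_head.
have ab : a != b by apply: contraNneq a_p => ->.
have next_b : next c b = v by rewrite -[RHS](next_prev Uc) prev_head.
have nab : ~~ adj a b.
  apply/negP => adj_ab; have E := no_chord a b a_c b_c adj_ab.
  rewrite next_b in E; have next_a : next c a = q by rewrite /c /= (negPf a_v) eqxx.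
  rewrite next_a in E; have b_q : b != q.
    case/and4P: Uc => _ _ q_p _; apply: contraNneq q_p => <-; exact: (mem_last r p').
  by rewrite (E b_q) eqxx in a_v.
have bv' : adj v b by rewrite adj_sym.
have /negP[] := HF v a b va bv' ab nab.
apply/connectP; exists p => //.
have ap_ok : all (fun w => [|| w == a, w == b | (w != v) && ~~ adj v w]) p.
  apply/allP => w wp; have wc := p_c w wp.
  have w_a : w != a by apply: contraNneq a_p => <-.
  have w_v : w != v by apply: contraNneq v_ap => <-; rewrite inE wp orbT.
  rewrite (negPf w_a) w_v /=; case: eqP => //= /eqP w_b; apply/negP => vw.
  have := no_chord v w v_c wc vw; rewrite next_v => /(_ w_a) E.
  by case/negP: w_b; rewrite -(prev_next Uc w) -E prev_head.
suff H s u : path adj u s -> all (fun w => [|| w == a, w == b | (w != v) && ~~ adj v w]) s ->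
    path (avoiding v a b) u s by exact: H.
elim: s u => [//|w s IHs] u /= /andP[uw ws] /andP[w_ok s_ok].
by rewrite {1}/avoiding uw w_ok IHs.
Qed.

(** A shortest walk from [a] to [b] is an induced path, and closing it through [v] yields a cycle of
    length at least four without chord. *)
Lemma chordal_hole_free : chordal_graph G -> hole_free.
Proof.
move=> CG v a b va vb ab nab; apply/negP => conn.
pose walk n := [exists s : n.-tuple V, path (avoiding v a b) a s && (last a s == b)].
have ex_walk : exists n, walk n.
  case/connectP: conn => s pth E; exists (size s); apply/existsP; exists (in_tuple s).
  by rewrite pth -E eqxx.
have [n /existsP[s /andP[pth /eqP last_s]] min_n] := ex_minnP ex_walk.
have {}min_n t : path (avoiding v a b) a t -> last a t = b -> n <= size t.
  move=> pt lt; apply: min_n; apply/existsP; exists (in_tuple t).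
  by rewrite pt lt eqxx.
have {s pth last_s} [s [size_s pth last_s]] : exists s, [/\ size s = n, path (avoiding v a b) a s & last a s = b].
  by exists s; rewrite size_tuple.
have last_take k : k <= size s -> last a (take k s) = nth a (a :: s) k.
  by move=> le_k; rewrite (last_nth a) size_takel //; case: k le_k => //= k lt_k; rewrite nth_take.
have s_ok w : w \in s -> [|| w == a, w == b | (w != v) && ~~ adj v w].
  case/(nthP a) => k lt_k <-.
  by have /(pathP a)/(_ k lt_k)/andP[] := pth.
(* An edge between vertices at distance at least two along the walk would give a shorter walk. *)
have no_shortcut i j : i < j -> j < size s -> ~~ adj (nth a (a :: s) i) (nth a s j).
  move=> lt_ij lt_j; apply/negP => adj_ij.
  have := min_n (take i s ++ drop j s); rewrite cat_path take_path // last_take; last lia.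
  rewrite (drop_nth a lt_j) /= {1}/avoiding adj_ij s_ok ?mem_nth //=.
  have := pth; rewrite -[s in path _ _ s](cat_take_drop j.+1) cat_path last_take // => /andP[_ ->].
  rewrite last_cat /= -[last _ _]/(last a (nth a s j :: drop j.+1 s)) -drop_nth //.
  have -> : last a (drop j s) = b.
    by rewrite -last_s -[in RHS](cat_take_drop j s) last_cat (drop_nth a lt_j).
  move/(_ isT (erefl _)); rewrite size_cat /= size_takel ?size_drop; lia.
have size_s1 : 1 < size s.
  case: s pth last_s {size_s last_take s_ok no_shortcut} => [_ E|c [|d s]] //.
    by move: ab; rewrite -E eqxx.
  by move=> /= /andP[/andP[ac _] _] E; rewrite -E ac in nab.
have av : a != v by apply: contraTneq va => ->; rewrite adj_irr.
have v_s : v \notin s.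
  apply/negP => /s_ok; rewrite eqxx /= orbF.
  by case/orP => /eqP E; [move: va|move: vb]; rewrite -E adj_irr.
have as_uniq : uniq (a :: s).
  case/shortenP: (pth) last_s => t pt Ut sub_ts last_t.
  apply: leq_size_uniq Ut _ _ => [w|]; last by rewrite /= ltnS size_s min_n.
  by rewrite !inE; case: eqP => //= _; apply: sub_ts.
pose c := v :: a :: s.
have c_cycle : ucycle adj c.
  apply/andP; split; last by rewrite /c cons_uniq as_uniq inE negb_or v_s eq_sym av.
  rewrite /c /= rcons_path va last_s adj_sym vb andbT.
  by apply: sub_path pth => x y /andP[].
have [//|u [w [uc wc uw wu uw']]] := CG c c_cycle.
have Uc : uniq c by case/andP: c_cycle.
have next_v : next c v = a by rewrite /c /= eqxx.
have next_b : next c b = v by rewrite -[RHS](next_prev Uc) prev_head //= last_s.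
have v_end x : x \in c -> adj v x -> x = a \/ x = b.
  rewrite !inE => /or3P[/eqP->|/eqP->|/s_ok]; [by rewrite adj_irr|by left|].
  by case/or3P => [/eqP ->|/eqP ->|/andP[_ /negPf->]]; [left|right|].
have [uv|uv] := eqVneq u v.
  rewrite uv in uw wu uw'; case: (v_end w wc uw) => E; rewrite E in wu uw'.
    by rewrite next_v eqxx in wu.
  by rewrite next_b eqxx in uw'.
have [wv|wv] := eqVneq w v.
  rewrite wv adj_sym in uw; rewrite wv in wu uw'; case: (v_end u uc uw) => E; rewrite E in wu uw'.
    by rewrite next_v eqxx in uw'.
  by rewrite next_b eqxx in wu.
have {}uc : u \in a :: s by move: uc; rewrite inE (negPf uv).
have {}wc : w \in a :: s by move: wc; rewrite inE (negPf wv).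
have next_nth_s i : i < size s -> next c (nth a (a :: s) i) = nth a s i.
  move=> lt_i; set x := nth _ _ _; have x_s : x \in a :: s by apply: mem_nth; rewrite /= ltnW.
  have idx : index x c = i.+1.
    rewrite -[LHS]/(if v == x then 0 else (index x (a :: s)).+1) ifN; first by rewrite /x index_uniq //= ltnW.
    apply: contraNneq v_s => E; move: x_s; rewrite -E inE eq_sym (negPf av).
    by [].
  have x_c : x \in c by rewrite in_cons x_s orbT.
  by rewrite next_nth x_c idx /=; apply: set_nth_default.
case/(nthP a): uc => i lt_i Ei; case/(nthP a): wc => j lt_j Ej.
wlog lt_ij : u w i j uw wu uw' uv wv Ei Ej lt_i lt_j / i < j.
  case: (ltngtP i j) => [lt_ij|lt_ji|eq_ij] H; first exact: (H u w i j).
    by apply: (H w u j i) => //; rewrite adj_sym.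
  by rewrite -Ei -Ej eq_ij adj_irr in uw.
case: j lt_j Ej lt_ij => // j lt_j Ej lt_ij.
(* Non-consecutive positions contradict [no_shortcut]; consecutive ones carry an edge of the cycle
   itself, which is not a chord. *)
have [lt_ij'|ge_ij] := ltnP i j.
  have := no_shortcut i j lt_ij' lt_j.
  by rewrite Ei -[nth a s j]/(nth a (a :: s) j.+1) Ej uw.
have eq_ij : i = j by apply/eqP; rewrite eqn_leq ge_ij -ltnS lt_ij.
by rewrite -Ei -Ej eq_ij next_nth_s ?eqxx in wu.
Qed.

(** One of the non-adjacent vertices [a] and [b] lies in the independent part, so its neighbours,
    [v] among them, lie in the clique. The vertex next to this end on the path is therefore [v] or a
    neighbour of [v], which the path has to avoid. *)
Lemma split_hole_free : split_graph G -> hole_free.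
Proof.
case=> S [indS cliS] v a b va vb ab nab; apply/negP => /connectP[s].
have K_of x y : x \in S -> adj x y -> y \notin S.
  by move=> xS xy; apply/negP => yS; have := indS x y xS yS; rewrite xy.
have cli x y : x \notin S -> y \notin S -> x != y -> adj x y.
  by move=> xS yS; apply: cliS; rewrite inE.
have [aS|aS] := boolP (a \in S).
  case: s => [_ E|w s /= /andP[/andP[aw /or3P w_ok] _] _]; first by rewrite E eqxx in ab.
  case: w_ok => [/eqP E|/eqP E|/andP[wv /negP[]]]; [by rewrite E adj_irr in aw|by rewrite -E aw in nab|].
  apply: cli; rewrite 1?eq_sym //; last exact: K_of aw.
  by apply: K_of aS _; rewrite adj_sym.
have bS : b \in S by apply: contraNT nab => bS; apply: cli.
have vS : v \notin S by apply: K_of bS _; rewrite adj_sym.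
elim/last_ind: s => [_ E|s w _]; first by rewrite E eqxx in ab.
rewrite rcons_path last_rcons => /andP[pth /andP[uw _]] E; rewrite -{w}E in uw.
have uS : last a s \notin S by apply: K_of bS _; rewrite adj_sym.
case/lastP: s pth uw uS => [|s u]; first by rewrite /= (negPf nab).
rewrite last_rcons rcons_path => /andP[_ /andP[_ /or3P u_ok]] ub uS.
case: u_ok => [/eqP E|/eqP E|/andP[uv /negP[]]]; [by rewrite -E ub in nab|by rewrite E adj_irr in ub|].
by apply: cli; rewrite // eq_sym.
Qed.

Lemma split_chordal : split_graph G -> chordal_graph G.
Proof. by move/split_hole_free/hole_free_chordal. Qed.

End Chordal.

(** * Certificates for the graph classes *)

Definition split_check n (m : nat -> nat -> bool) (c : word) :=
  all (fun i => all (fun j =>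
    [&& nth false c i && nth false c j ==> ~~ m i j
      & [&& ~~ nth false c i, ~~ nth false c j & i != j] ==> m i j])
    (iota 0 n)) (iota 0 n).

Definition quad n v a b z := ((v * n + a) * n + b) * n + z.

(* For every [v] and every pair [a], [b] of non-adjacent neighbours of [v], the
   certificate lists a set which contains [a] but not [b] and is closed under
   the steps of [avoiding v a b]. *)
Definition chordal_check n (m : nat -> nat -> bool) (c : word) :=
  all (fun v => all (fun a => all (fun b =>
    [&& m v a, m v b, a != b & ~~ m a b] ==>
    [&& nth false c (quad n v a b a), ~~ nth false c (quad n v a b b)
      & all (fun z => all (fun w =>
          [&& nth false c (quad n v a b z), m z w
            & [|| w == a, w == b | (w != v) && ~~ m v w]] ==>
          nth false c (quad n v a b w)) (iota 0 n)) (iota 0 n)])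
    (iota 0 n)) (iota 0 n)) (iota 0 n).

Lemma any_in_NP : in_NP (yes (Offensive_Alliance any_graph)).
Proof.
apply: (@in_NP_Offensive_Alliance _ (fun _ _ _ => true)) => [G m _ _|//|]; first by exists [::].
exact: def_const.
Qed.

Lemma split_in_NP : in_NP (yes (Offensive_Alliance split_graph)).
Proof.
apply: (@in_NP_Offensive_Alliance _ split_check) => [G m Em [S [indS cliS]]|G m c Em chk|].
- pose c := [seq i \in S | i <- enum 'I_(order G)]; exists c.
    by rewrite size_map size_enum_ord; case: (order G) => // k; rewrite -{1}[k.+1]expn1 leq_pexp2l.
  have cE (i : 'I_(order G)) : nth false c i = (i \in S).
    by rewrite (nth_map i) ?size_enum_ord // nth_ord_enum.
  rewrite /split_check all_iota_ord; apply/forallP => i; rewrite all_iota_ord; apply/forallP => j.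
  rewrite !cE Em; apply/andP; split; apply/implyP; first by case/andP; apply: indS.
  by case/and3P => iS jS ij; apply: cliS; rewrite ?inE.
- exists [set i : 'I_(order G) | nth false c i].
  have {}chk (i j : 'I_(order G)) : _ := forallP (etrans (esym (all_iota_ord _ _)) (forallP (etrans (esym (all_iota_ord _ _)) chk) i)) j.
  by split=> i j; rewrite !inE => ci cj; have /andP[] := chk i j; rewrite ci cj Em //= => _ /implyP.
- by rewrite /split_check; definable.
Qed.

Lemma quad_lt n v a b z : v < n -> a < n -> b < n -> z < n -> quad n v a b z < n ^ 4.
Proof.
have H k x y : x < k -> y < n -> x * n + y < k * n by nia.
by move=> lt_v lt_a lt_b lt_z; rewrite /quad !expnSr expn0 mul1n; do 3!apply: (H) => //.
Qed.

Lemma chordal_in_NP : in_NP (yes (Offensive_Alliance chordal_graph)).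
Proof.
apply: (@in_NP_Offensive_Alliance _ chordal_check) => [G m Em CG|G m c Em chk|].
- have HF := chordal_hole_free CG; set n := order G.
  (* The set listed for [v], [a], [b] is all that can be reached from [a]; it omits [b] by [HF]. *)
  pose C q := [exists v : 'I_n, exists a : 'I_n, exists b : 'I_n, exists z : 'I_n,
    (q == quad n v a b z) && connect (avoiding v a b) a z].
  exists (mkseq C (n ^ 4)); first by rewrite size_mkseq.
  have CE (v a b z : 'I_n) : nth false (mkseq C (n ^ 4)) (quad n v a b z) = connect (avoiding v a b) a z.
    rewrite nth_mkseq ?quad_lt //; apply/existsP/idP => [[v' /existsP[a' /existsP[b' /existsP[z' /andP[/eqP E]]]]]|H].
      have inj x y (i j : 'I_n) : x * n + i = y * n + j -> x = y /\ i = j.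
        move=> E'; have n_gt0 : 0 < n by apply: leq_trans (ltn_ord i).
        have := congr1 (divn^~ n) E'; rewrite !divnMDl // !divn_small // !addn0 => Exy.
        by split=> //; apply/val_inj; move: E'; rewrite Exy => /addnI.
      have [/inj[/inj[Ev Ea] Eb] Ez] := inj _ _ _ _ E.
      by rewrite (val_inj Ev) Ea Eb Ez.
    by exists v; apply/existsP; exists a; apply/existsP; exists b; apply/existsP; exists z; rewrite eqxx.
  rewrite /chordal_check all_iota_ord; apply/forallP => v; rewrite all_iota_ord; apply/forallP => a.
  rewrite all_iota_ord; apply/forallP => b; rewrite !Em; apply/implyP => /and4P[va vb ab nab].
  rewrite !CE connect0 HF //= all_iota_ord; apply/forallP => z.
  rewrite all_iota_ord; apply/forallP => w; rewrite !CE !Em; apply/implyP => /and3P[az zw w_ok].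
  by apply: connect_trans az (connect1 _); rewrite /avoiding zw.
- apply: hole_free_chordal => v a b va vb ab nab; apply/negP => /connectP[s pth last_s].
  move: chk; rewrite /chordal_check all_iota_ord => /forallP/(_ v).
  rewrite all_iota_ord => /forallP/(_ a); rewrite all_iota_ord => /forallP/(_ b).
  rewrite !Em va vb ab nab /= => /and3P[ca cb cP].
  have closed (z w : 'I_(order G)) : avoiding v a b z w ->
      nth false c (quad (order G) v a b z) -> nth false c (quad (order G) v a b w).
    move=> /andP[zw w_ok] cz; move: cP; rewrite all_iota_ord => /forallP/(_ z).
    by rewrite all_iota_ord => /forallP/(_ w); rewrite cz !Em zw w_ok.
  case/negP: cb; rewrite {2}last_s.
  suff H u : path (avoiding v a b) u s -> nth false c (quad (order G) v a b u) ->
      nth false c (quad (order G) v a b (last u s)) by exact: H.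
  elim: s u {pth last_s} => //= w s IHs u /andP[uw ws] cu.
  exact: IHs ws (closed _ _ uw cu).
- by rewrite /chordal_check /quad; definable.
Qed.

(** * From hitting sets to offensive alliances in split graphs *)

Lemma sum_nat_split a b (F : nat -> nat) :
  \sum_(0 <= i < a + b) F i = \sum_(0 <= i < a) F i + \sum_(0 <= i < b) F (a + i).
Proof.
rewrite (big_cat_nat _ (n := a)) ?leq_addr //=; congr (_ + _).
by rewrite -{1}[a]add0n big_addn addKn; apply: eq_bigr => i _; rewrite addnC.
Qed.

Lemma leq_sum_nat n (F F' : nat -> nat) : (forall i, i < n -> F i <= F' i) ->
  \sum_(0 <= i < n) F i <= \sum_(0 <= i < n) F' i.
Proof. by move=> H; rewrite !big_mkord; apply: leq_sum => i _; apply: H. Qed.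

Lemma sum_nat_le_count n (P : nat -> bool) : \sum_(0 <= i < n) P i <= n.
Proof. by rewrite sum_count -[X in _ <= X](size_iota 0 n) count_size. Qed.

Lemma sum_nat_eq1 n k : k < n -> \sum_(0 <= i < n) (i == k) = 1.
Proof.
move=> lt_k; rewrite (sum_count n (pred1 k)) count_uniq_mem ?iota_uniq //.
by rewrite mem_iota lt_k.
Qed.

Lemma sum_nat0 n (F : nat -> nat) : (forall i, i < n -> F i = 0) -> \sum_(0 <= i < n) F i = 0.
Proof. by move=> H; rewrite big_mkord big1 // => i _; apply: H. Qed.

Lemma sum_nat_true n (P : nat -> bool) : (forall i, i < n -> P i) -> \sum_(0 <= i < n) P i = n.
Proof.
move=> H; rewrite -[RHS]muln1 -[in RHS](subn0 n) -sum_nat_const_nat.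
by apply: eq_big_nat => i /= lt_i; rewrite H.
Qed.

Section HittingSet.

(* A set system [mem 0], ..., [mem (M - 1)] of subsets of {0, ..., u - 1}, and
   the size [k] of the hitting set.  The vertices of the graph are, in this
   order: [heads] vertices that every small alliance contains, one vertex per
   element, one per set, and [tails] vertices adjacent to all the heads. *)
Variables (u M k : nat) (mem : nat -> nat -> bool).

(** An element outside of the alliance has at most [u - 1] elements and [M] sets as outside
    neighbours, so [u + M] heads inside give it the required majority. *)
Definition heads := u + M.
Definition budget := heads + k.
(** At most [budget] vertices cannot be a strict majority among [2 * budget] or more neighbours. *)
Definition tails := budget.*2.
Definition hs_order := heads + u + M + tails.
Definition set_size w := \sum_(0 <= l < u) mem w l.

Definition hs_half_adj a b :=
  if b < heads + u then true
  else if b < heads + u + M then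
    if a < heads then a < set_size (b - (heads + u))
    else (a < heads + u) && mem (b - (heads + u)) (a - heads)
  else a < heads.

Definition hs_adj a b :=
  if a < b then hs_half_adj a b else if b < a then hs_half_adj b a else false.

Lemma hs_adj_sym a b : hs_adj a b = hs_adj b a.
Proof. by rewrite /hs_adj; case: (ltngtP a b). Qed.

Lemma hs_adj_irr a : hs_adj a a = false.
Proof. by rewrite /hs_adj ltnn. Qed.

Definition hs_graph : graph :=
  mk_graph (fun i j : 'I_hs_order => hs_adj_sym i j) (fun i : 'I_hs_order => hs_adj_irr i).

Lemma hs_graph_agrees : agrees hs_graph hs_adj.
Proof. by []. Qed.

Lemma hs_adj_core a b : a < heads + u -> b < heads + u -> hs_adj a b = (a != b).
Proof. by move=> lt_a lt_b; rewrite /hs_adj /hs_half_adj lt_a lt_b; case: ltngtP. Qed.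

Lemma hs_adj_outer a b : heads + u <= a -> heads + u <= b -> hs_adj a b = false.
Proof.
move=> le_a le_b; have [Ea Eb] : (a < heads) = false /\ (b < heads) = false by split; lia.
by rewrite /hs_adj /hs_half_adj !(ltnNge _ (heads + u)) le_a le_b Ea Eb /= !if_same.
Qed.

Lemma hs_adj_head_set i w : i < heads -> w < M -> hs_adj i (heads + u + w) = (i < set_size w).
Proof.
move=> lt_i lt_w; rewrite /hs_adj /hs_half_adj ifT; last lia.
rewrite ifF; last lia; rewrite ifT; last lia.
by rewrite lt_i addKn.
Qed.

Lemma hs_adj_elt_set l w : l < u -> w < M -> hs_adj (heads + l) (heads + u + w) = mem w l.
Proof.
move=> lt_l lt_w; rewrite /hs_adj /hs_half_adj ifT; last lia.
rewrite ifF; last lia; rewrite ifT; last lia; rewrite ifF; last lia.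
by rewrite !addKn ltn_add2l lt_l.
Qed.

Lemma hs_adj_tail a d : a < heads + u -> hs_adj a (heads + u + M + d) = (a < heads).
Proof.
move=> lt_a; rewrite /hs_adj /hs_half_adj ifT; last lia.
by rewrite ifF; last lia; rewrite ifF; last lia.
Qed.

Lemma hs_graph_split : split_graph hs_graph.
Proof.
exists [set i : 'I_hs_order | heads + u <= i]; split=> i j; rewrite !inE.
  by move=> le_i le_j; rewrite [adj _ _]hs_adj_outer.
by rewrite -!ltnNge => lt_i lt_j ij; rewrite [adj _ _]hs_adj_core.
Qed.

Lemma hs_sum_split (F : nat -> nat) : \sum_(0 <= i < hs_order) F i =
  \sum_(0 <= i < heads) F i + \sum_(0 <= l < u) F (heads + l) +
  \sum_(0 <= w < M) F (heads + u + w) + \sum_(0 <= d < tails) F (heads + u + M + d).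
Proof. by rewrite /hs_order !sum_nat_split. Qed.

Hypothesis mem_nonempty : forall w, w < M -> has (mem w) (iota 0 u).
Hypothesis u_gt0 : 0 < u.

Lemma heads_gt0 : 0 < heads. Proof. by rewrite /heads; lia. Qed.

Lemma set_size_leq w : set_size w <= heads.
Proof. by apply: leq_trans (sum_nat_le_count _ _) _; apply: leq_addr. Qed.

Lemma set_size_gt0 w : w < M -> 0 < set_size w.
Proof. by move=> lt_w; rewrite /set_size (sum_count u (mem w)) -has_count mem_nonempty. Qed.

Lemma set_size_splits (H : nat -> bool) w :
  set_size w = \sum_(0 <= l < u) (H l && mem w l) + \sum_(0 <= l < u) (~~ H l && mem w l).
Proof. by rewrite -big_split; apply: eq_bigr => l _; case: (H l); case: (mem w l). Qed.

Lemma degree_set P w : w < M ->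
  degree_nat hs_order hs_adj P (heads + u + w) =
    \sum_(0 <= i < heads) (P i && (i < set_size w)) +
    \sum_(0 <= l < u) (P (heads + l) && mem w l).
Proof.
move=> lt_w; rewrite /degree_nat hs_sum_split.
rewrite [X in _ + X + _]sum_nat0 => [|i lt_i]; last by rewrite hs_adj_outer ?andbF //; lia.
rewrite [X in _ + X]sum_nat0 => [|i lt_i]; last by rewrite hs_adj_outer ?andbF //; lia.
rewrite !addn0; congr (_ + _); apply: eq_big_nat => i /= lt_i.
  by rewrite hs_adj_sym hs_adj_head_set.
by rewrite hs_adj_sym hs_adj_elt_set.
Qed.

Lemma hitting_set_alliance (H : nat -> bool) :
  \sum_(0 <= l < u) H l <= k ->
  (forall w, w < M -> has (fun l => mem w l && H l) (iota 0 u)) ->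
  exists2 P, alliance_nat hs_order hs_adj P & \sum_(0 <= i < hs_order) P i <= budget.
Proof.
move=> H_le H_hits; have h0 := heads_gt0.
(* The alliance consists of all heads and of the elements of the hitting set. *)
pose P v := (v < heads) || [&& heads <= v, v < heads + u & H (v - heads)].
have P_head i : i < heads -> P i by rewrite /P => ->.
have P_elt l : l < u -> P (heads + l) = H l.
  by move=> lt_l; rewrite /P ltnNge leq_addr ltn_add2l lt_l addKn.
have P_outer i : heads + u <= i -> P i = false by rewrite /P => le_i; rewrite !ltnNge; lia.
exists P; last first.
  rewrite hs_sum_split sum_nat_true //.
  rewrite [X in _ + X + _]sum_nat0 => [|i lt_i]; last by rewrite P_outer //; lia.
  rewrite [X in _ + X]sum_nat0 => [|i lt_i]; last by rewrite P_outer //; lia.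
  rewrite !addn0 leq_add2l; apply: leq_trans H_le; apply: leq_sum_nat => l lt_l.
  by rewrite P_elt.
rewrite /alliance_nat; apply/andP; split.
  by apply/hasP; exists 0; [rewrite mem_iota /hs_order; lia|exact: P_head].
apply/allP => v; rewrite mem_iota => /= lt_v; apply/implyP => /andP[Pv _].
have v_ge : heads <= v by rewrite leqNgt; apply: contra Pv; apply: P_head.
have [lt_v1|le_v1] := ltnP v (heads + u).
  set l := v - heads; have v_def : v = heads + l by lia.
  have lt_l : l < u by lia.
  have Hl : H l = false by apply: negbTE; rewrite -(P_elt l lt_l) -v_def.
  have degP : heads <= degree_nat hs_order hs_adj P v.
    rewrite /degree_nat hs_sum_split [X in X + _ + _ + _]sum_nat_true; first lia.
    by move=> i lt_i; rewrite P_head // hs_adj_core //; lia.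
  apply: leq_trans degP; rewrite /degree_nat hs_sum_split.
  rewrite [X in X + _ + _ + _ + 1]sum_nat0 => [|i lt_i]; last by rewrite P_head.
  rewrite [X in _ + X + 1]sum_nat0 => [|i lt_i]; last by rewrite hs_adj_tail // ltnNge v_ge andbF.
  have le_sets := sum_nat_le_count M (fun w => ~~ P (heads + u + w) && hs_adj v (heads + u + w)).
  (* The unit in the offensive condition is paid for by [v], which is an outside element but not its
     own neighbour. *)
  have le_elts : \sum_(0 <= i < u) (~~ P (heads + i) && hs_adj v (heads + i)) + 1 <= u.
    rewrite -(sum_nat_eq1 lt_l) -big_split -[X in _ <= X](sum_nat_true (P := xpredT) (n := u)) //.
    apply: leq_sum_nat => i lt_i /=; rewrite hs_adj_core ?ltn_add2l // v_def eqn_add2l eq_sym.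
    by case: eqP => //=; case: (P _).
  by move: le_sets le_elts => /=; rewrite /heads; lia.
have [lt_v2|le_v2] := ltnP v (heads + u + M).
  (* The [set_size w] heads next to [w] are all inside. With [h] elements hit, the condition is
     [set_size w - h + 1 <= set_size w + h], which holds as soon as [h] is positive. *)
  set w := v - (heads + u); have v_def : v = heads + u + w by lia.
  have lt_w : w < M by lia.
  rewrite v_def !degree_set //.
  rewrite [X in X + _ + _ <= _]sum_nat0 => [|i lt_i]; last by rewrite P_head.
  have -> : \sum_(0 <= i < heads) (P i && (i < set_size w)) = set_size w.
    rewrite -[RHS](sum_ltn (set_size_leq w)); apply: eq_big_nat => i /= lt_i.
    by rewrite P_head.
  rewrite (set_size_splits H w).
  have -> : \sum_(0 <= l < u) (P (heads + l) && mem w l) = \sum_(0 <= l < u) (H l && mem w l).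
    by apply: eq_big_nat => l /= lt_l; rewrite P_elt.
  have -> : \sum_(0 <= l < u) (~~ P (heads + l) && mem w l) = \sum_(0 <= l < u) (~~ H l && mem w l).
    by apply: eq_big_nat => l /= lt_l; rewrite P_elt.
  have : 0 < \sum_(0 <= l < u) (H l && mem w l).
    rewrite (sum_count u (fun l => H l && mem w l)) -has_count.
    by rewrite (eq_has (a2 := fun l => mem w l && H l)) ?H_hits // => l /=; rewrite andbC.
  lia.
set d := v - (heads + u + M); have v_def : v = heads + u + M + d by lia.
apply: (@leq_trans heads).
  rewrite /degree_nat hs_sum_split [X in X + _ + _ + _ + 1]sum_nat0 => [|i lt_i]; last by rewrite P_head.
  rewrite [X in 0 + X + _ + _ + 1]sum_nat0 => [|l lt_l].
    rewrite [X in _ + X + _ + 1]sum_nat0 => [|i lt_i]; last by rewrite hs_adj_outer ?andbF //; lia.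
    rewrite [X in _ + X + 1]sum_nat0 => [|i lt_i]; last by rewrite hs_adj_outer ?andbF //; lia.
    exact: h0.
  by rewrite v_def hs_adj_sym hs_adj_tail ?andbF ?ltn_add2l // [_ < heads]ltnNge leq_addr andbF.
rewrite /degree_nat hs_sum_split [X in X + _ + _ + _]sum_nat_true; first lia.
by move=> i lt_i; rewrite P_head // v_def hs_adj_sym hs_adj_tail //; lia.
Qed.

(** The alliance may contain set vertices. Each is exchanged for one element of its set, which hits
    the set and does not increase the size; the sets outside are hit by the offensive condition, all
    heads being inside. *)
Lemma alliance_hitting_set P : alliance_nat hs_order hs_adj P ->
  \sum_(0 <= i < hs_order) P i <= budget ->
  exists2 H : nat -> bool, \sum_(0 <= l < u) H l <= k &
    forall w, w < M -> has (fun l => mem w l && H l) (iota 0 u).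
Proof.
move=> /andP[/hasP[s]]; rewrite mem_iota => /= lt_s Ps /allP all_v P_le; have h0 := heads_gt0.
have touched v t : v < hs_order -> t < hs_order -> ~~ P v -> P t -> hs_adj t v ->
    degree_nat hs_order hs_adj (fun i => ~~ P i) v + 1 <= degree_nat hs_order hs_adj P v.
  move=> lt_v lt_t Pv Pt tv; have := all_v v; rewrite mem_iota /= lt_v Pv => /(_ isT)/implyP; apply.
  by apply/hasP; exists t; rewrite ?mem_iota ?Pt.
(* If head [v] were outside, the tails alone would give it [2 * budget] neighbours, of which at most
   [budget] are inside. *)
have P_head v t : v < heads -> t < hs_order -> P t -> hs_adj t v -> P v.
  move=> lt_v lt_t Pt tv; rewrite -[P v]negbK; apply/negP => Pv.
  have lt_v' : v < hs_order by rewrite /hs_order; lia.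
  have := touched v t lt_v' lt_t Pv Pt tv.
  have degP : degree_nat hs_order hs_adj P v <= budget.
    by apply: leq_trans P_le; apply: leq_sum_nat => i _; case: (P i); case: (hs_adj _ _).
  have : tails <= degree_nat hs_order hs_adj P v + degree_nat hs_order hs_adj (fun i => ~~ P i) v.
    rewrite -big_split /= hs_sum_split; apply: leq_trans (leq_addl _ _).
    rewrite -[X in X <= _](sum_nat_true (P := xpredT) (n := tails)) //; apply: leq_sum_nat => d lt_d /=.
    by rewrite hs_adj_tail ?lt_v; [case: (P _)|lia].
  by rewrite /tails; lia.
(* Every other vertex is adjacent to head 0, set vertices because their sets are non-empty; so any
   member of the alliance forces head 0 into it. *)
have P0 : P 0.
  have [s0|s0] := posnP s; first by rewrite -s0.
  have [lt_s1|le_s1] := ltnP s (heads + u).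
    by apply: (P_head 0 s) => //; rewrite hs_adj_core //; lia.
  apply: (P_head 0 s) => //; have [lt_s2|le_s2] := ltnP s (heads + u + M).
    have -> : s = heads + u + (s - (heads + u)) by lia.
    by rewrite hs_adj_sym hs_adj_head_set ?set_size_gt0 //; lia.
  have -> : s = heads + u + M + (s - (heads + u + M)) by lia.
  by rewrite hs_adj_sym hs_adj_tail //; lia.
have {}P_head i : i < heads -> P i.
  case: i => // i lt_i; apply: (P_head i.+1 0) => //; first by rewrite /hs_order; lia.
  by rewrite hs_adj_core //; lia.
pose pick w := find (mem w) (iota 0 u).
have pick_lt w : w < M -> pick w < u by move/mem_nonempty; rewrite has_find size_iota.
have pick_mem w : w < M -> mem w (pick w).
  by move=> lt_w; have := nth_find 0 (mem_nonempty lt_w); rewrite nth_iota ?pick_lt.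
pose H l := P (heads + l) || has (fun w => P (heads + u + w) && (pick w == l)) (iota 0 M).
exists H.
  have le_H l : H l <= P (heads + l) + \sum_(0 <= w < M) (P (heads + u + w) && (pick w == l)).
    rewrite (sum_count M (fun w => P (heads + u + w) && (pick w == l))) /H has_count.
    by case: (P _); case: (count _ _).
  apply: leq_trans (leq_sum_nat (fun l _ => le_H l)) _; rewrite big_split /= exchange_big /=.
  have le_sets : \sum_(0 <= w < M) \sum_(0 <= l < u) (P (heads + u + w) && (pick w == l)) <=
      \sum_(0 <= w < M) P (heads + u + w).
    apply: leq_sum_nat => w lt_w; case: (P _) => /=; last by rewrite sum_nat0.
    by rewrite (eq_bigr (fun l => nat_of_bool (l == pick w))) ?sum_nat_eq1 ?pick_lt // => l _; rewrite eq_sym.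
  have := P_le; rewrite hs_sum_split sum_nat_true // /budget.
  by move: le_sets; lia.
move=> w lt_w; have [Pw|Pw] := boolP (P (heads + u + w)).
  apply/hasP; exists (pick w); first by rewrite mem_iota pick_lt.
  rewrite pick_mem //; apply/orP; right; apply/hasP; exists w; first by rewrite mem_iota.
  by rewrite Pw eqxx.
have := touched (heads + u + w) 0 _ _ Pw P0; rewrite !degree_set // hs_adj_head_set // set_size_gt0 //.
rewrite [X in X + _ + _ <= _]sum_nat0 => [|i lt_i]; last by rewrite P_head.
have -> : \sum_(0 <= i < heads) (P i && (i < set_size w)) = set_size w.
  rewrite -[RHS](sum_ltn (set_size_leq w)); apply: eq_big_nat => i /= lt_i.
  by rewrite P_head.
rewrite (set_size_splits (fun l => P (heads + l)) w).
move=> /(_ _ _ isT) ineq; have : 0 < \sum_(0 <= l < u) (P (heads + l) && mem w l).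
  by have := ineq _ _; rewrite /hs_order; lia.
rewrite (sum_count u (fun l => P (heads + l) && mem w l)) -has_count.
by apply: sub_has => l /= /andP[Pl ->]; rewrite /H Pl.
Qed.

End HittingSet.

(** * From tableaux to hitting sets *)

Lemma sum_pairs n (F : nat -> nat) :
  \sum_(0 <= l < n.*2) F l = \sum_(0 <= i < n) (F i.*2 + F i.*2.+1).
Proof.
elim: n => [|n IHn]; first by rewrite !big_geq.
by rewrite doubleS !big_nat_recr //= IHn addnA.
Qed.

Lemma sum_leq_eq1 n (F : nat -> nat) : (forall i, i < n -> 0 < F i) ->
  \sum_(0 <= i < n) F i <= n -> forall i, i < n -> F i = 1.
Proof.
move=> F_gt0 le_n i lt_i.
have E : \sum_(0 <= j < n) F j = \sum_(0 <= j < n) (F j).-1 + n.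
  rewrite -[X in _ = _ + X](sum_nat_true (n := n) (P := xpredT)) // -big_split /=.
  by apply: eq_big_nat => j /= lt_j; rewrite addn1 prednK ?F_gt0.
have : (F i).-1 <= \sum_(0 <= j < n) (F j).-1.
  by rewrite big_mkord (bigD1 (Ordinal lt_i)) //= leq_addr.
have := F_gt0 i lt_i; lia.
Qed.

Lemma divn_pair b i j : j < b -> (i * b + j) %/ b = i.
Proof. by move=> lt_j; rewrite divnMDl ?divn_small ?addn0 //; lia. Qed.

Lemma modn_pair b i j : j < b -> (i * b + j) %% b = j.
Proof. by move=> lt_j; rewrite modnMDl modn_small. Qed.

Lemma divn2_pair i (s : bool) : (i.*2 + s) %/ 2 = i.
Proof. by rewrite -muln2 divn_pair //; case: s. Qed.

Lemma odd_pair i (s : bool) : odd (i.*2 + s) = s.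
Proof. by rewrite oddD odd_double; case: s. Qed.

Definition input_symbol (w : word) p : option bool :=
  if p < size w then Some (nth false w p) else None.

Definition table m (t : nat -> nat) i := if i < m then t i else 0.

Section Tableau.

(* Configurations are bi-infinite words cut at the head and folded into a
   sequence of columns; column 0 determines the transition, so that the next
   value of a column depends on column 0 and on its two neighbours. *)
Variables (S : finType) (g : S -> S -> S -> S -> S).
Variables (init : bool -> option bool -> option bool -> S) (acc0 acc1 : pred S).

Fixpoint run (x y : word) t p : S :=
  if t is t'.+1 then
    g (run x y t' 0) (run x y t' p.-1) (run x y t' p) (run x y t' p.+1)
  else init (p == 0) (input_symbol x p) (input_symbol y p).

Hypothesis init_inj : forall b o, injective (init b o).

Local Notation m := #|S|.

Definition code (s : S) : nat := enum_rank s.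

Definition decode v : S := nth (init false None None) (enum S) v.

Lemma code_lt s : code s < m.
Proof. exact: ltn_ord. Qed.

Lemma codeK : cancel code decode.
Proof. exact: nth_enum_rank. Qed.

Lemma card_value_gt0 : 0 < m.
Proof. by apply/card_gt0P; exists (init false None None). Qed.

(** The code is 0 for a blank, 1 for [false] and 2 for [true]. *)
Definition symbol_of_nat e : option bool :=
  if e is e'.+1 then Some (e' == 1) else None.

(** A window is a number below [m ^ 4], whose base [m] digits are column 0, the left neighbour, the
    column itself and the right neighbour. *)
Definition digit c i := c %/ m ^ i %% m.

Definition next_table c :=
  code (g (decode (digit c 0)) (decode (digit c 1)) (decode (digit c 2)) (decode (digit c 3))).

Definition init_table i :=
  code (init (i %/ 9 == 1) (symbol_of_nat (i %/ 3 %% 3)) (symbol_of_nat (i %% 3))).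

(** The 18 entries combine two cases for the column (0 or not) with three for each input (blank,
    [false], [true]). *)
Definition initial_code (x : word) p e := table 18 init_table
  ((p == 0) * 9 + (if p < size x then nth false x p + 1 else 0) * 3 + e).

Lemma initial_codeE x p e : e < 3 ->
  initial_code x p e = code (init (p == 0) (input_symbol x p) (symbol_of_nat e)).
Proof.
move=> lt_e; rewrite /initial_code /table /init_table /input_symbol.
by case: (p == 0); case: (p < size x); [case: (nth _ _ _)| |case: (nth _ _ _)|];
  case: e lt_e => [|[|[|]]].
Qed.

(* The literal of variable "column [p] has value [v] at time [t]" with sign [s]
   belongs to clause [c] of the given kind at time [t0] and column [p0]. *)
Definition clause (x : word) (N B : nat) kind t0 p0 c t p v (s : bool) : bool :=
  if kind == 0 then
    [&& t0 < N, p0 <= N & c < m ^ 4] ==>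
    [|| [&& t == t0, p == 0, v == digit c 0 & ~~ s],
        [&& t == t0, p == p0.-1, v == digit c 1 & ~~ s],
        [&& t == t0, p == p0, v == digit c 2 & ~~ s],
        [&& t == t0, p == p0.+1, v == digit c 3 & ~~ s]
      | [&& t == t0.+1, p == p0, v == table (m ^ 4) next_table c & s]]
  else if kind == 1 then
    [&& t == 0, p == p0, s &
      (v == initial_code x p0 0) ||
      (p0 < B) && ((v == initial_code x p0 1) || (v == initial_code x p0 2))]
  else if kind == 2 then
    (p0 <= N) ==>
    ([&& t == 0, p == p0, v == initial_code x p0 0 & ~~ s] ||
     [&& t == 0, p == p0.+1, v == initial_code x p0.+1 0 & s])
  else if kind == 3 then
    (table m (fun i => ~~ acc0 (decode i)) c == 1) ==>
    [&& t == N, p == 0, v == c & ~~ s]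
  else if kind == 4 then
    (table m (fun i => ~~ acc1 (decode i)) c == 1) ==>
    [&& t == N, p == 1, v == c & ~~ s]
  else (c < m) ==> [&& t == t0, p == p0 & v == c].

(** The six kinds are transitions, initial columns, persistence of blanks to the right in the second
    input, the two acceptance conditions, and complementary literals. Where the guard of a clause
    fails, the set contains all literals, so the indices fill a box and every set is non-empty. *)
Definition clause_count N := (N.+1 * N.+2 * m ^ 4) * 6.
Definition var_count N := N.+1 * N.+2 * m.

Definition clause_mem x N B q l :=
  clause x N B (q %% 6) (q %/ 6 %/ m ^ 4 %/ N.+2) (q %/ 6 %/ m ^ 4 %% N.+2) (q %/ 6 %% m ^ 4)
    (l %/ 2 %/ m %/ N.+2) (l %/ 2 %/ m %% N.+2) (l %/ 2 %% m) (odd l).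

Section Reduction.

Variables (x : word) (N B : nat).
Local Notation mem := (clause_mem x N B).

Definition literal t p v (s : bool) := ((t * N.+2 + p) * m + v).*2 + s.
Definition clause_index kind t p c := ((t * N.+2 + p) * m ^ 4 + c) * 6 + kind.

Lemma pair_lt a b i j : i < a -> j < b -> i * b + j < a * b.
Proof. by nia. Qed.

Lemma literal_lt t p v s : t <= N -> p < N.+2 -> v < m -> literal t p v s < (var_count N).*2.
Proof.
move=> le_t lt_p lt_v; have := pair_lt (pair_lt (le_t : t < N.+1) lt_p) lt_v.
by rewrite /literal /var_count; case: s; lia.
Qed.

Lemma clause_index_lt kind t p c : kind < 6 -> t <= N -> p < N.+2 -> c < m ^ 4 ->
  clause_index kind t p c < clause_count N.
Proof.
move=> lt_kind le_t lt_p lt_c; apply: pair_lt lt_kind.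
by apply: pair_lt lt_c; apply: pair_lt.
Qed.

Lemma mem_literal kind t0 p0 c t p v s :
  kind < 6 -> p0 < N.+2 -> c < m ^ 4 -> p < N.+2 -> v < m ->
  mem (clause_index kind t0 p0 c) (literal t p v s) = clause x N B kind t0 p0 c t p v s.
Proof.
move=> lt_kind lt_p0 lt_c lt_p lt_v; rewrite /clause_mem /clause_index /literal.
by rewrite divn2_pair odd_pair !(divn_pair, modn_pair).
Qed.

Lemma literal_inv l : l < (var_count N).*2 ->
  exists t p v s, [/\ t <= N, p < N.+2, v < m & l = literal t p v s].
Proof.
move=> lt_l; exists (l %/ 2 %/ m %/ N.+2), (l %/ 2 %/ m %% N.+2), (l %/ 2 %% m), (odd l).
split; rewrite ?ltn_mod ?card_value_gt0 //.
  by rewrite -ltnS !ltn_divLR // ?card_value_gt0 // -?mulnA -/(var_count N); rewrite /var_count in lt_l *; lia.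
by rewrite /literal -divn_eq -divn_eq -{1}(odd_double_half l) divn2 addnC.
Qed.

Lemma clause_index_inv q : q < clause_count N ->
  exists kind t p c, [/\ kind < 6, t <= N, p < N.+2, c < m ^ 4 & q = clause_index kind t p c].
Proof.
move=> lt_q; have m4 : 0 < m ^ 4 by rewrite expn_gt0 card_value_gt0.
exists (q %% 6), (q %/ 6 %/ m ^ 4 %/ N.+2), (q %/ 6 %/ m ^ 4 %% N.+2), (q %/ 6 %% m ^ 4).
split; rewrite ?ltn_mod //; last by rewrite /clause_index -!divn_eq.
by rewrite -ltnS !ltn_divLR // -?mulnA; rewrite /clause_count in lt_q *; lia.
Qed.

Lemma has_literal q (H : nat -> bool) t p v s :
  t <= N -> p < N.+2 -> v < m -> mem q (literal t p v s) -> H (literal t p v s) ->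
  has (fun l => mem q l && H l) (iota 0 (var_count N).*2).
Proof.
move=> le_t lt_p lt_v ml Hl; apply/hasP; exists (literal t p v s); last by rewrite ml.
by rewrite mem_iota literal_lt.
Qed.

Lemma digit_lt c i : digit c i < m.
Proof. by rewrite ltn_mod card_value_gt0. Qed.

Lemma clause_mem_nonempty q : q < clause_count N -> has (mem q) (iota 0 (var_count N).*2).
Proof.
case/clause_index_inv=> kind [t [p [c [lt_k le_t lt_p lt_c ->]]]].
suff [t' [p' [v' [s' [le_t' lt_p' lt_v' cl]]]]] : exists t' p' v' s',
    [/\ t' <= N, p' < N.+2, v' < m & clause x N B kind t p c t' p' v' s'].
  rewrite (eq_has (a2 := fun l => mem (clause_index kind t p c) l && true)); last by move=> l; rewrite andbT.
  by apply: (has_literal (H := xpredT) le_t' lt_p' lt_v' (s := s')) => //; rewrite mem_literal.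
have m0 := card_value_gt0.
case: kind lt_k => [|[|[|[|[|[|]]]]]] // _.
- by exists t, 0, (digit c 0), false; split; rewrite ?digit_lt // /clause /= !eqxx ?implybT.
- exists 0, p, (initial_code x p 0), true; rewrite /clause /= !eqxx; split=> //.
  by rewrite initial_codeE ?code_lt.
- exists 0, p, (initial_code x p 0), false; rewrite /clause /= !eqxx ?implybT; split=> //.
  by rewrite initial_codeE ?code_lt.
- exists N, 0, (if c < m then c else 0), false; split=> //; first by case: ifP.
  by rewrite /clause /= !eqxx /table; case: ifP => _; rewrite ?eqxx ?implybT.
- exists N, 1, (if c < m then c else 0), false; split=> //; first by case: ifP.
  by rewrite /clause /= !eqxx /table; case: ifP => _; rewrite ?eqxx ?implybT.
- exists t, p, (if c < m then c else 0), false; split=> //; first by case: ifP.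
  by rewrite /clause /= !eqxx /=; case: ifP => _; rewrite ?eqxx ?implybT.
Qed.

Lemma initial_code_lt p e : e < 3 -> initial_code x p e < m.
Proof. by move=> lt_e; rewrite initial_codeE ?code_lt. Qed.

Lemma run_hitting_set y : size y <= B -> acc0 (run x y N 0) -> acc1 (run x y N 1) ->
  exists2 H : nat -> bool, \sum_(0 <= l < (var_count N).*2) H l <= var_count N &
    forall q, q < clause_count N -> has (fun l => mem q l && H l) (iota 0 (var_count N).*2).
Proof.
move=> le_y a0 a1.
(* The true literals of the run, one from each complementary pair. *)
pose H l := odd l == (l %/ 2 %% m == code (run x y (l %/ 2 %/ m %/ N.+2) (l %/ 2 %/ m %% N.+2))).
have HE t p v s : p < N.+2 -> v < m -> H (literal t p v s) = (s == (v == code (run x y t p))).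
  move=> lt_p lt_v; rewrite /H /literal.
  by rewrite divn2_pair odd_pair !(divn_pair, modn_pair).
exists H.
  rewrite sum_pairs -[X in _ <= X](sum_nat_true (n := var_count N) (P := xpredT)) //.
  apply: leq_sum_nat => i _.
  have E (b : bool) : H (i.*2 + b) = (b == (i %% m == code (run x y (i %/ m %/ N.+2) (i %/ m %% N.+2)))).
    by rewrite /H divn2_pair odd_pair.
  by have := E false; have := E true; rewrite addn0 addn1 => -> ->; case: (_ == code _).
move=> q /clause_index_inv[kind [t [p [c [lt_k le_t lt_p lt_c ->]]]]].
have lit t' p' v' s' : t' <= N -> p' < N.+2 -> v' < m -> clause x N B kind t p c t' p' v' s' ->
    s' = (v' == code (run x y t' p')) ->
    has (fun l => mem (clause_index kind t p c) l && H l) (iota 0 (var_count N).*2).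
  move=> le_t' lt_p' lt_v' cl s_def; apply: (has_literal le_t' lt_p' lt_v' (s := s')).
    by rewrite mem_literal.
  by rewrite HE // s_def eqxx.
have m0 := card_value_gt0.
case: kind lt_k lit => [|[|[|[|[|[|]]]]]] // _ lit.
- have [/and3P[lt_t le_p _]|invalid] := boolP [&& t < N, p <= N & c < m ^ 4]; last first.
    by apply: (lit 0 0 0 (0 == code (run x y 0 0))) => //; rewrite /clause /= (negPf invalid).
  (* Either the window [c] differs from the run in some place, and a negative literal hits the
     clause, or it is the actual window, and the positive literal does. *)
  have [E0|N0] := eqVneq (digit c 0) (code (run x y t 0)); last first.
    apply: (lit t 0 (digit c 0) false) => //; first exact: digit_lt.
      by rewrite /clause /= !eqxx implybT.
    by rewrite (negPf N0).
  have [E1|N1] := eqVneq (digit c 1) (code (run x y t p.-1)); last first.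
    apply: (lit t p.-1 (digit c 1) false) => //; [lia|exact: digit_lt| |by rewrite (negPf N1)].
    by rewrite /clause /= !eqxx !orbT implybT.
  have [E2|N2] := eqVneq (digit c 2) (code (run x y t p)); last first.
    apply: (lit t p (digit c 2) false) => //; [exact: digit_lt| |by rewrite (negPf N2)].
    by rewrite /clause /= !eqxx !orbT implybT.
  have [E3|N3] := eqVneq (digit c 3) (code (run x y t p.+1)); last first.
    apply: (lit t p.+1 (digit c 3) false) => //; [exact: digit_lt| |by rewrite (negPf N3)].
    by rewrite /clause /= !eqxx !orbT implybT.
  apply: (lit t.+1 p (code (run x y t.+1 p)) true) => //; [exact: code_lt| |by rewrite eqxx].
  by rewrite /clause /table lt_c /next_table E0 E1 E2 E3 !codeK /= !eqxx !orbT implybT.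
- apply: (lit 0 p (code (run x y 0 p)) true) => //; [exact: code_lt| |by rewrite eqxx].
  rewrite /clause /= !eqxx /= !initial_codeE // /input_symbol.
  case: (ltnP p (size y)) => [lt_py|_]; last by rewrite eqxx.
  rewrite (leq_trans lt_py le_y) /= (_ : (0 == 1) = false) // (_ : (1 == 1) = true) //.
  by case: (nth _ y p); rewrite eqxx ?orbT.
- have [le_p|gt_p] := leqP p N; last first.
    by apply: (lit 0 0 0 (0 == code (run x y 0 0))) => //; rewrite /clause /= leqNgt gt_p.
  have [E|NE] := eqVneq (initial_code x p 0) (code (run x y 0 p)); last first.
    apply: (lit 0 p (initial_code x p 0) false) => //; [exact: initial_code_lt| |by rewrite (negPf NE)].
    by rewrite /clause /= !eqxx implybT.
  apply: (lit 0 p.+1 (initial_code x p.+1 0) true) => //; first exact: initial_code_lt.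
    by rewrite /clause /= !eqxx !orbT implybT.
  (* Injectivity of [init] turns the equality of codes into the absence of a letter of [y] in column
     [p], hence also in column [p.+1]. *)
  move: E; rewrite !initial_codeE // => /(can_inj codeK)/init_inj; rewrite /= /input_symbol.
  case: (ltnP p (size y)) => // le_yp _.
  by rewrite (ltnNge p.+1 (size y)) leqW //= eqxx.
- have [bad|ok] := boolP (table m (fun i => ~~ acc0 (decode i)) c == 1); last first.
    by apply: (lit 0 0 0 (0 == code (run x y 0 0))) => //; rewrite /clause /= (negPf ok).
  have lt_cm : c < m by move: bad; rewrite /table; case: ifP.
  apply: (lit N 0 c false) => //; first by rewrite /clause /= !eqxx implybT.
  by move: bad; rewrite /table lt_cm; case: (c =P _) => // ->; rewrite codeK a0.
- have [bad|ok] := boolP (table m (fun i => ~~ acc1 (decode i)) c == 1); last first.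
    by apply: (lit 0 0 0 (0 == code (run x y 0 0))) => //; rewrite /clause /= (negPf ok).
  have lt_cm : c < m by move: bad; rewrite /table; case: ifP.
  apply: (lit N 1 c false) => //; first by rewrite /clause /= !eqxx implybT.
  by move: bad; rewrite /table lt_cm; case: (c =P _) => // ->; rewrite codeK a1.
- have [lt_cm|le_cm] := ltnP c m; last first.
    by apply: (lit 0 0 0 (0 == code (run x y 0 0))) => //; rewrite /clause /= ltnNge le_cm.
  by apply: (lit t p c (c == code (run x y t p))) => //; rewrite /clause /= !eqxx implybT.
Qed.

Lemma hitting_set_run (H : nat -> bool) : B <= N ->
  \sum_(0 <= l < (var_count N).*2) H l <= var_count N ->
  (forall q, q < clause_count N -> has (fun l => mem q l && H l) (iota 0 (var_count N).*2)) ->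
  exists y, [/\ size y <= B, acc0 (run x y N 0) & acc1 (run x y N 1)].
Proof.
move=> le_BN H_le H_hits; have m0 := card_value_gt0; have m4 : m <= m ^ 4 by rewrite -{1}[m]expn1 leq_pexp2l.
have hit kind t p c : kind < 6 -> t <= N -> p < N.+2 -> c < m ^ 4 ->
    exists t' p' v' s', [/\ t' <= N, p' < N.+2, v' < m, clause x N B kind t p c t' p' v' s' &
      H (literal t' p' v' s')].
  move=> lt_k le_t lt_p lt_c.
  case/hasP: (H_hits _ (clause_index_lt lt_k le_t lt_p lt_c)) => l; rewrite mem_iota => /= lt_l /andP[ml Hl].
  have [t' [p' [v' [s' [le_t' lt_p' lt_v' l_def]]]]] := literal_inv lt_l.
  exists t', p', v', s'; split=> //; last by rewrite -l_def.
  by move: ml; rewrite l_def mem_literal.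
(* The clauses of kind 5 demand at least one literal per variable, and the budget leaves no room for
   a second. *)
have pair i : i < var_count N -> H i.*2 + H i.*2.+1 = 1.
  move=> lt_i; apply: (sum_leq_eq1 (F := fun i => H i.*2 + H i.*2.+1)) lt_i; last first.
    by rewrite -(sum_pairs _ (fun l => nat_of_bool (H l))).
  move=> j lt_j; have lt_l : j.*2 < (var_count N).*2 by rewrite ltn_double.
  have [t [p [v [s [le_t lt_p lt_v l_def]]]]] := literal_inv lt_l.
  have j_def : j = (t * N.+2 + p) * m + v by rewrite -[LHS]doubleK l_def -divn2 divn2_pair.
  have [t' [p' [v' [s' [_ _ _]]]]] := hit 5 t p v isT le_t lt_p (leq_trans lt_v m4).
  rewrite /clause /= lt_v /= => /and3P[/eqP -> /eqP -> /eqP ->]; rewrite /literal -j_def.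
  by case: s'; rewrite ?addn1 ?addn0 => ->; rewrite ?addn1 ?add1n.
pose h t p v := H (literal t p v true).
have h_neg t p v : t <= N -> p < N.+2 -> v < m -> H (literal t p v false) = ~~ h t p v.
  move=> le_t lt_p lt_v; rewrite /h /literal addn1 addn0.
  have := pair _ (pair_lt (pair_lt (le_t : t < N.+1) lt_p) lt_v).
  by case: (H _); case: (H _).
have h_init p : p < N.+2 -> h 0 p (initial_code x p 0) \/
    p < B /\ (h 0 p (initial_code x p 1) \/ h 0 p (initial_code x p 2)).
  move=> lt_p; have [t' [p' [v' [s' [_ _ _]]]]] := hit 1 0 p 0 isT isT lt_p (leq_trans m0 m4).
  rewrite /clause /= => /and4P[/eqP -> /eqP -> ->]; rewrite -/(h 0 p v').
  by case/orP => [/eqP ->|/andP[lt_pB /orP[] /eqP ->]]; [left|right; split=> //; left|right; split=> //; right].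
have h_blank p : p <= N -> h 0 p (initial_code x p 0) -> h 0 p.+1 (initial_code x p.+1 0).
  move=> le_p hp; have lt_p : p < N.+2 by rewrite ltnW.
  have [t' [p' [v' [s' [_ _ _]]]]] := hit 2 0 p 0 isT isT lt_p (leq_trans m0 m4).
  rewrite /clause /= le_p /= => /orP[] /and4P[/eqP -> /eqP -> /eqP ->]; last by move->.
  by move/negPf ->; rewrite h_neg ?hp // initial_code_lt.
pose blank p := h 0 p (initial_code x p 0).
(* The certificate is cut at the first column marked blank; later columns may also admit letters,
   but the clauses of kind 2 make their blank value true as well. *)
pose L := find blank (iota 0 B).
have le_L : L <= B by rewrite -[X in _ <= X](size_iota 0 B) find_size.
pose y := mkseq (fun p => h 0 p (initial_code x p 2)) L.
have blank_ge p : L <= p -> p < N.+2 -> blank p.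
  elim: p => [|p IHp].
    rewrite leqn0 => /eqP L0 lt_p; have [//|[lt_B _]] := h_init 0 lt_p.
    have has_blank : has blank (iota 0 B) by rewrite has_find size_iota -/L L0.
    by have := nth_find 0 has_blank; rewrite -/L L0 nth_iota.
  rewrite leq_eqVlt => /orP[/eqP L_def|lt_L] lt_p; last by apply: h_blank; [lia|apply: IHp; lia].
  have [//|[lt_B _]] := h_init _ lt_p; rewrite -L_def in lt_B.
  have has_blank : has blank (iota 0 B) by rewrite has_find size_iota.
  by have := nth_find 0 has_blank; rewrite -/L nth_iota // add0n -L_def.
have run0 p : p < N.+2 -> h 0 p (code (run x y 0 p)).
  move=> lt_p; rewrite /= /input_symbol size_mkseq -/(input_symbol x p).
  case: (ltnP p L) => [lt_pL|le_Lp]; last by rewrite -(initial_codeE x p (e := 0)) //; apply: blank_ge.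
  have : ~~ blank p.
    by have := before_find 0 lt_pL; rewrite nth_iota ?(leq_trans lt_pL) // add0n => ->.
  rewrite nth_mkseq //; case: (h_init p lt_p) => [|[_ hp]]; first by rewrite /blank => ->.
  move=> _; have [E|/negbTE E] := boolP (h 0 p (initial_code x p 2)).
    by rewrite -[Some true]/(symbol_of_nat 2) -initial_codeE.
  rewrite -[Some false]/(symbol_of_nat 1) -initial_codeE //.
  by case: hp => //; rewrite E.
(* A transition reads the right neighbour, so one column is lost per step: of the [N.+2] columns at
   time 0, columns 0 and 1 remain at time [N]. *)
have runP t p : t <= N -> p + t < N.+2 -> h t p (code (run x y t p)).
  elim: t p => [|t IHt] p le_t lt_pt; first by apply: run0; lia.
  set c0 := run x y t 0; set c1 := run x y t p.-1; set c2 := run x y t p; set c3 := run x y t p.+1.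
  pose c := ((code c3 * m + code c2) * m + code c1) * m + code c0.
  have lt_c : c < m ^ 4 by rewrite !expnSr expn0 mul1n; do 3!(apply: pair_lt; last exact: code_lt); apply: code_lt.
  have [d0 d1 d2 d3] : [/\ digit c 0 = code c0, digit c 1 = code c1, digit c 2 = code c2 & digit c 3 = code c3].
    have lt s := code_lt s.
    rewrite /digit !expnSr expn0 !mul1n !divnMA divn1.
    by rewrite !(divn_pair, modn_pair) // modn_small.
  have [t' [p' [v' [s' [_ _ _]]]]] := hit 0 t p c isT (ltnW le_t) (leq_ltn_trans (leq_addr _ p) lt_pt) lt_c.
  rewrite /clause /= le_t lt_c (_ : p <= N) /=; last lia.
  rewrite d0 d1 d2 d3 /table lt_c /next_table d0 d1 d2 d3 !codeK.
  case/or4P => [| | |/orP[]] /and4P[/eqP-> /eqP-> /eqP-> sgn]; last by rewrite sgn.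
  - by rewrite (negPf sgn) h_neg ?IHt ?code_lt //; lia.
  - by rewrite (negPf sgn) h_neg ?IHt ?code_lt //; lia.
  - by rewrite (negPf sgn) h_neg ?IHt ?code_lt //; lia.
  - by rewrite (negPf sgn) h_neg ?IHt ?code_lt //; lia.
exists y; split; first by rewrite size_mkseq.
- apply/negPn/negP => bad; have lt_c := code_lt (run x y N 0).
  have [t' [p' [v' [s' [_ _ _]]]]] := hit 3 0 0 _ isT isT isT (leq_trans lt_c m4).
  rewrite /clause /= /table lt_c codeK bad /= => /and4P[/eqP-> /eqP-> /eqP-> /negPf->].
  by rewrite h_neg ?runP // ?add0n //; lia.
- apply/negPn/negP => bad; have lt_c := code_lt (run x y N 1).
  have [t' [p' [v' [s' [_ _ _]]]]] := hit 4 0 0 _ isT isT isT (leq_trans lt_c m4).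
  rewrite /clause /= /table lt_c codeK bad /= => /and4P[/eqP-> /eqP-> /eqP-> /negPf->].
  by rewrite h_neg ?runP // ?add1n //; lia.
Qed.

End Reduction.

End Tableau.

Ltac definable_leaf ::=
  lazymatch goal with
  | |- definable (fun x y v => table ?m ?t (@?f x y v)) => apply (@def_table m t f)
  end.

Lemma def_clause_mem (S : finType) g init (acc0 acc1 : pred S) (N B : word -> nat)
    (f h : word -> word -> env -> nat) :
  definable (fun x y v => N x) -> definable (fun x y v => B x) -> definable f -> definable h ->
  definable (fun x y v => clause_mem g init acc0 acc1 x (N x) (B x) (f x y v) (h x y v)).
Proof.
move=> HN HB Hf Hh; rewrite /clause_mem /clause /initial_code /digit.
by definable.
Qed.

(** * Tableaux of Turing machines *)

Section Columns.

Variable M : machine.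

Local Notation sym := (symbol (work_symbol M)).
Local Notation syms := {ffun 'I_(last_tape M).+1 -> sym}.

(* A mark for column 0, the letter of the second input in this column, the
   state, and the symbols at this distance to the left and to the right of each
   head.  The second component makes [initial_column] injective even when the
   machine has a single tape. *)
Definition column : finType := (bool * option bool * state M * syms * syms)%type.

Definition mark (s : column) := s.1.1.1.1.
Definition ghost (s : column) := s.1.1.1.2.
Definition control (s : column) := s.1.1.2.
Definition lefts (s : column) := s.1.2.
Definition rights (s : column) := s.2.

Definition column_of (y : word) (c : config M) p : column :=
  (p == 0, input_symbol y p, c.1,
   [ffun i => nth None (lside (c.2 i)) p], [ffun i => nth None (rside (c.2 i)) p]).

(** A head move shifts the two halves of a tape by one column in opposite directions. The mark of
    [sb] tells column 0, where symbols cross the cut; the mark of [sa] tells column 1, which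
    receives the written symbol when the head goes left. In column 0 itself [sa] is marked too,
    hence the order of the tests. *)
Definition next_column (s0 sa sb sc : column) : column :=
  if halting (control s0) then sb else
  let: (q, act) := delta (control s0) (rights s0) in
  (mark sb, ghost sb, q,
   [ffun i => let: (a, d) := act i in
     match d with
     | GoLeft => lefts sc i
     | Stay => lefts sb i
     | GoRight => if mark sb then a else lefts sa i
     end],
   [ffun i => let: (a, d) := act i in
     match d with
     | GoLeft => if mark sb then lefts s0 i else if mark sa then a else rights sa i
     | Stay => if mark sb then a else rights sb i
     | GoRight => rights sc i
     end]).

Definition initial_column b (o o' : option bool) : column :=
  (b, o', start M, [ffun => None],
   [ffun i : 'I_(last_tape M).+1 =>
      omap inl (if val i is 0 then o else if val i is 1 then o' else None)]).

Lemma initial_column_inj b o : injective (initial_column b o).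
Proof. by move=> o1 o2 []. Qed.

Lemma column_of_step y c p : column_of y (step c) p =
  next_column (column_of y c 0) (column_of y c p.-1) (column_of y c p) (column_of y c p.+1).
Proof.
rewrite /next_column /step /halted /control /=.
have [hc|nhc] := boolP (halting c.1).
  by [].
rewrite /rights /=.
have -> : [ffun i => nth None (rside (c.2 i)) 0] = [ffun i => scanned (c.2 i)].
  by apply/ffunP => i; rewrite !ffunE nth0.
case: (delta _ _) => q act; rewrite /column_of /mark /ghost /lefts /=.
congr (_, _, _, _, _); apply/ffunP => i; rewrite !ffunE /=; case: (act i) => a [] /=;
  case: (c.2 i) => l r /=; rewrite ?nth_behead ?nth0 ?ffunE //.
- by case: p.
- by case: p => [|[|p]] //=; rewrite nth_behead.
- by case: p => [|p] //=; rewrite nth_behead.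
Qed.

Lemma nth_input_word (w : word) p :
  nth None [seq Some (inl b) : sym | b <- w] p = omap inl (input_symbol w p).
Proof.
rewrite /input_symbol; case: ltnP => [lt_p|le_p]; first by rewrite (nth_map false).
by rewrite nth_default // size_map.
Qed.

Lemma column_of_initial x y p : column_of y (initial M [:: x; y]) p =
  initial_column (p == 0) (input_symbol x p) (input_symbol y p).
Proof.
rewrite /column_of /initial_column /=; congr (_, _, _, _, _); apply/ffunP => i; rewrite !ffunE /=.
  by rewrite nth_nil.
rewrite nth_input_word; case: (val i) => [|[|j]] //=.
by rewrite nth_nil.
Qed.

Lemma run_columns x y t p : run next_column initial_column x y t p =
  column_of y (iter t (@step M) (initial M [:: x; y])) p.
Proof.
elim: t p => [|t IHt] p; first by rewrite column_of_initial.
by rewrite iterS column_of_step /= !IHt.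
Qed.

Definition accepting0 (s : column) := halting (control s) && (rights s ord0 == Some (inl true)).

(** The output is a single letter only if the next cell holds no bit, so acceptance has to inspect
    column 1. *)
Definition accepting1 (s : column) := if rights s ord0 is Some (inl _) then false else true.

Lemma acceptingP y c : halted c && (output c == [:: true]) =
  accepting0 (column_of y c 0) && accepting1 (column_of y c 1).
Proof.
rewrite /halted /output /accepting0 /accepting1 /column_of /control /rights /= !ffunE.
case: (halting c.1) => //=; case: (c.2 ord0) => l [|[[b|a]|] r] //=.
by case: b; case: r => [|[[b|a]|] r].
Qed.

Lemma iter_step_stable x y n n' : n <= n' -> halted (iter n (@step M) (initial M [:: x; y])) ->
  iter n' (@step M) (initial M [:: x; y]) = iter n (@step M) (initial M [:: x; y]).
Proof.
move=> /subnK <- hc; rewrite iterD; set c := iter n _ _ in hc *.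
by elim: (n' - n) => //= d ->; rewrite /step hc.
Qed.

Lemma accepting_run x y (b : bool) n n' : n <= n' -> outputs_within M [:: x; y] n [:: b] ->
  accepting0 (run next_column initial_column x y n' 0) &&
  accepting1 (run next_column initial_column x y n' 1) = b.
Proof.
move=> le_n [hc out]; rewrite !run_columns -acceptingP (iter_step_stable le_n hc) hc out.
by case: b {out}.
Qed.

End Columns.

(** * The output of the reduction, letter by letter *)

Definition halves i r := iteri i (fun _ u => u./2) r.

Lemma halvesE i r : halves i r = value (drop i (bits r)).
Proof.
elim: i => [|i IHi]; first by rewrite drop0 value_bits.
rewrite /halves iteriS -/(halves i r) IHi; move: (bits r) => w.
have [lt_i|le_i] := ltnP i (size w); last by rewrite !drop_oversize // ltnW.
by rewrite (drop_nth false lt_i) /= half_bit_double.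
Qed.

Lemma nth_bits r i : i < size (bits r) -> nth false (bits r) i = odd (halves i r).
Proof.
move=> lt_i; rewrite halvesE (drop_nth false lt_i) /= oddD odd_double addbF.
by case: (nth _ _ _).
Qed.

Lemma size_leq_value w : last false w -> size w <= value w.
Proof.
elim: w => [|b w IHw] //=; case: w IHw => [|c w] IHw H; first by case: b H.
have le_w : size (c :: w) <= value (c :: w) by apply: IHw.
apply: (@leq_trans (value (c :: w)).*2); last exact: leq_addl.
by rewrite -addnn -add1n leq_add // value_gt0.
Qed.

Lemma size_bits r : 0 < r -> size (bits r) = \sum_(0 <= i < r) (0 < halves i r).
Proof.
move=> r_gt0; have last_r := last_bits r_gt0.
have le_r : size (bits r) <= r by rewrite -[X in _ <= X]value_bits size_leq_value.
rewrite -[LHS](sum_ltn le_r); apply: eq_bigr => i _; congr nat_of_bool.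
have [lt_i|le_i] := ltnP i (size (bits r)); last by rewrite halvesE drop_oversize.
rewrite halvesE value_gt0 //; move: last_r; rewrite -[in last _ _](cat_take_drop i (bits r)) last_cat.
by rewrite (drop_nth false lt_i).
Qed.

(** The form required by [definable_polytime_function]: a length and a letter for each position. *)
Lemma encode_nat_mkseq n m r : 0 < r -> encode_nat n m (bits r) =
  mkseq (fun q =>
      if q <= n then q < n
      else if q < n + 1 + n * n then m ((q - n.+1) %/ n) ((q - n.+1) %% n)
      else odd (halves (q - (n + 1 + n * n)) r))
    (n + 1 + n * n + \sum_(0 <= i < r) (0 < halves i r)).
Proof.
move=> r_gt0; rewrite -size_bits //; apply: (@eq_from_nth _ false) => [|q].
  by rewrite size_encode size_mkseq.
rewrite size_encode => lt_q; rewrite nth_mkseq // nth_cat size_nseq.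
have [lt_qn|gt_qn|->] := ltngtP q n; first by rewrite nth_nseq lt_qn.
  rewrite -(subnSK gt_qn) /= nth_cat size_mkseq.
  have -> : (q - n.+1 < n * n) = (q < n + 1 + n * n) by lia.
  case: ifP => lt_q'; first by rewrite nth_mkseq //; lia.
  have -> : q - n.+1 - n * n = q - (n + 1 + n * n) by lia.
  by rewrite nth_bits //; lia.
by rewrite subnn.
Qed.

Lemma def_halves f g : definable f -> definable g ->
  definable (fun x y v => halves (f x y v) (g x y v)).
Proof.
move=> Hf Hg; apply: (def_iteri (b := g) (F := fun _ _ _ _ u => u./2)) => //.
  by definable.
by move=> x y v _ u le_u; apply: leq_trans le_u; rewrite -divn2 leq_div.
Qed.

(** * Hardness *)

Ltac definable_leaf ::=
  lazymatch goal with
  | |- definable (fun x y v => halves (@?f x y v) (@?g x y v)) => apply (@def_halves f g)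
  | |- definable (fun x y v => nat_of_bool
        (clause_mem ?g ?init ?acc0 ?acc1 x (?N x) (?B x) (@?f x y v) (@?h x y v))) =>
      apply (@def_clause_mem _ g init acc0 acc1 N B f h)
  end.

(** A yes-instance is given through its word, so the graph behind it is known only up to its order
    and adjacency values. Comparing through predicates on natural numbers avoids transporting vertex
    sets along an equality of orders. *)
Lemma encode_hs_agrees G' r' u M k mem r :
  encode (hs_graph u M k mem) r = encode G' r' ->
  [/\ order G' = hs_order u M k, agrees G' (hs_adj u M mem) & r' = r].
Proof.
rewrite (encodeE r (@hs_graph_agrees u M k mem)) (encodeE r' (@nat_adj_agrees G')) => E.
have nE : order G' = hs_order u M k by have := congr1 graph_size E; rewrite !graph_size_encode.
split=> //; last by have := congr1 radius_bits E; rewrite !radius_bits_encode => /(congr1 value); rewrite !value_bits.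
move=> i j; rewrite -nat_adj_agrees -(@matrix_entry_encode (order G') (@nat_adj G') (bits r')) // -E.
by rewrite matrix_entry_encode //= -nE.
Qed.

Section Hardness.

Variables (L : language) (M : machine) (V : word -> word -> bool) (c k c' k' : nat).
Hypothesis V_M : forall x y,
  outputs_within M [:: x; y] (c' * (size x + size y) ^ k' + c') [:: V x y].
Hypothesis L_V : forall x, L x <-> exists y, size y <= c * size x ^ k + c /\ V x y.

Definition witness_bound (x : word) := c * size x ^ k + c.

(** The first summand provides the inequality required by [hitting_set_run]; the rest bounds the
    machine on the longest admissible certificate. *)
Definition time_bound (x : word) :=
  witness_bound x + (c' * (size x + witness_bound x) ^ k' + c').

Local Notation mem x := (clause_mem (@next_column M) (@initial_column M) (@accepting0 M)
  (@accepting1 M) x (time_bound x) (witness_bound x)).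
Local Notation vars x := (var_count (column M) (time_bound x)).
Local Notation clauses x := (clause_count (column M) (time_bound x)).
Local Notation graph_of x := (hs_graph (vars x).*2 (clauses x) (vars x) (mem x)).
Local Notation radius x := (budget (vars x).*2 (clauses x) (vars x)).

Lemma vars_gt0 x : 0 < (vars x).*2.
Proof. by rewrite double_gt0 /var_count !muln_gt0 /= card_value_gt0 //; exact: (@initial_column M). Qed.

Lemma radius_gt0 x : 0 < radius x.
Proof. by rewrite /budget addn_gt0 heads_gt0 // vars_gt0. Qed.

Lemma le_bounds x : witness_bound x <= time_bound x.
Proof. exact: leq_addr. Qed.

Lemma run_accepts x y : size y <= witness_bound x ->
  accepting0 (run (@next_column M) (@initial_column M) x y (time_bound x) 0) &&
  accepting1 (run (@next_column M) (@initial_column M) x y (time_bound x) 1) = V x y.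
Proof.
move=> le_y; apply: accepting_run (V_M x y); apply: leq_trans (leq_addl _ _).
rewrite leq_add2r leq_mul2l; apply/orP; right.
by case: k' => // j; rewrite leq_exp2r // leq_add2l.
Qed.

Lemma polytime_reduction : polytime_function (fun x => encode (graph_of x) (radius x)).
Proof.
have HB : definable (fun x y v => witness_bound x) by rewrite /witness_bound; definable.
have HN : definable (fun x y v => time_bound x) by rewrite /time_bound; definable.
pose n x := hs_order (vars x).*2 (clauses x) (vars x).
pose len x := n x + 1 + n x * n x + \sum_(0 <= i < radius x) (0 < halves i (radius x)).
pose b x q :=
  if q <= n x then q < n x
  else if q < n x + 1 + n x * n x then
    hs_adj (vars x).*2 (clauses x) (mem x) ((q - (n x).+1) %/ n x) ((q - (n x).+1) %% n x)
  else odd (halves (q - (n x + 1 + n x * n x)) (radius x)).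
have Hn : definable (fun x y v => n x).
  by rewrite /n /hs_order /tails /budget /heads /var_count /clause_count; definable.
have Hlen : definable (fun x y v => len x).
  by rewrite /len /budget /heads /var_count /clause_count; definable.
have Hb : definable (fun x y v => b x (v 0)).
  rewrite /b /hs_adj /hs_half_adj /set_size /budget /heads /clause_count.
  rewrite /var_count; definable.
have [M0 [c0 [k0 H]]] := definable_polytime_function Hlen Hb.
exists M0, c0, k0 => x.
by rewrite (encodeE _ (@hs_graph_agrees _ _ _ (mem x))) encode_nat_mkseq ?radius_gt0.
Qed.

Lemma reduction_instance (C : graph -> Prop) x : (forall G, split_graph G -> C G) ->
  OA_instance C (encode (graph_of x) (radius x)).
Proof.
move=> splitC; exists (graph_of x), (radius x); split=> //; last exact: radius_gt0.
exact: splitC (hs_graph_split _ _ _ _).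
Qed.

Lemma reduction_correct (C : graph -> Prop) x : (forall G, split_graph G -> C G) ->
  L x <-> OA_yes C (encode (graph_of x) (radius x)).
Proof.
move=> splitC; have mem_ne w := @clause_mem_nonempty _ (@next_column M) (@initial_column M)
  (@accepting0 M) (@accepting1 M) x (time_bound x) (witness_bound x) w.
have inj := @initial_column_inj M; have u0 := vars_gt0 x.
split=> [/L_V[y [le_y Vxy]]|].
  have := run_accepts le_y; rewrite Vxy => /andP[a0 a1].
  have [H H_le H_hits] := run_hitting_set inj le_y a0 a1.
  have [P al P_le] := hitting_set_alliance u0 H_le H_hits.
  exists (graph_of x), (radius x); split=> //; [exact: splitC (hs_graph_split _ _ _ _)|exact: radius_gt0|].
  have /(alliance_natP P (@hs_graph_agrees _ _ _ (mem x))) al' := al.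
  exists [set i : 'I_(order (graph_of x)) | P i]; split=> //.
  by rewrite card_gt0 (card_set_nat _ P) P_le andbT; case: al'.
case=> G [r [_ _ /encode_hs_agrees[nG aG ->] [S [al /andP[_ S_le]]]]].
pose P i := if insub i is Some a then a \in S else false.
have S_def : S = [set i : 'I_(order G) | P i] by apply/setP => i; rewrite inE /P valK.
have al_nat : alliance_nat (order G) (hs_adj (vars x).*2 (clauses x) (mem x)) P.
  by apply/(alliance_natP P aG); rewrite -S_def.
rewrite nG in al_nat; rewrite S_def (card_set_nat _ P) nG in S_le.
have [H H_le H_hits] := alliance_hitting_set mem_ne u0 al_nat S_le.
have [y [le_y a0 a1]] := hitting_set_run (le_bounds x) H_le H_hits.
by apply/L_V; exists y; split=> //; rewrite -(run_accepts le_y) a0 a1.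
Qed.

End Hardness.

Lemma split_NP_hard (C : graph -> Prop) : (forall G, split_graph G -> C G) ->
  NP_hard (Offensive_Alliance C).
Proof.
move=> splitC L [V [c [k [[M [c' [k' V_M]]] L_V]]]].
eexists; split; first exact: (@polytime_reduction M c k c' k').
move=> x; split; last exact: (reduction_correct V_M L_V).
exact: reduction_instance.
Qed.

Theorem theorem10 :
  NP_complete (Offensive_Alliance any_graph) /\
  NP_complete (Offensive_Alliance split_graph) /\
  NP_complete (Offensive_Alliance chordal_graph).
Proof.
split; first by split; [exact: any_in_NP|exact: split_NP_hard].
split; first by split; [exact: split_in_NP|exact: split_NP_hard].
split; first exact: chordal_in_NP.
exact: split_NP_hard split_chordal.
Qed.
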